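(* Let $d\ge 1$, let $\mathcal I$ be a finite set of labels, $\eta_0\in\mathcal I$, and let $p_0=\sum_{\eta\in\mathcal I} w_\eta p_\eta$ be a mixture distribution on $\mathbb R^d$ with weights $w_\eta\ge 0$, $\sum_{\eta} w_\eta=1$, $w_{\eta_0}>0$, where each $p_\eta$ is a probability density supported on a convex compact set $K_\eta\subseteq\mathbb R^d$ having at least one interior point, $K_\eta\cap K_{\eta'}=\emptyset$ for all $\eta\neq\eta'$, and $\inf_{x\in K_{\eta_0}}p_{\eta_0}(x)>0$. Let $T>0$ and $\gamma\ge 1$. Then for any starting location $x_0\in\mathbb R^d$ and any solution $(x_t)_{0\le t<T}$ started at $x_0$ of the guided SDE $$\mathrm d x_t=\big(x_t+2\nabla\log p_{T-t}(x_t)+2\gamma\nabla\log p_{T-t}(\eta_0\mid x_t)\big)\,\mathrm d t+\sqrt2\,\mathrm d B_t,$$ where $(B_t)_{t\ge0}$ is a standard $d$-dimensional Brownian motion, almost surely $$\lim_{t\to T^-}\operatorname{dist}(x_t,K_{\eta_0})=0 .$$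
   Context: For $t>0$ set $\lambda_t=e^{-t}$, $\sigma_t=\sqrt{1-\lambda_t^2}$, $\phi_t(z)=(\sqrt{2\pi}\,\sigma_t)^{-d}\exp(-\|z\|^2/(2\sigma_t^2))$, and $$p_t(x)=\sum_{\eta\in\mathcal I}w_\eta\int p_\eta(u)\,\phi_t(x-\lambda_t u)\,\mathrm d u,\qquad p_t(\eta_0\mid x)=\frac{w_{\eta_0}\int p_{\eta_0}(u)\,\phi_t(x-\lambda_t u)\,\mathrm d u}{p_t(x)} .$$ All gradients are with respect to $x$. $\|\cdot\|$ is the Euclidean norm and $\operatorname{dist}(x,A)=\inf_{y\in A}\|x-y\|$. *)

(* Defs.v *)
From HB Require Import structures.
From mathcomp Require Import all_boot all_order all_algebra.
From mathcomp Require Import all_classical all_reals all_analysis.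

Set Implicit Arguments.
Unset Strict Implicit.
Unset Printing Implicit Defensive.

Import Order.TTheory GRing.Theory Num.Theory.
Import numFieldNormedType.Exports.

Local Open Scope classical_set_scope.
Local Open Scope ring_scope.

(* Row vectors carry the product sigma-algebra, generated by the coordinates,
   exactly as the library does for tuples; over the reals it is the Borel
   sigma-algebra of R^n. *)
Definition measure_rV_display : measure_display -> measure_display.
Proof. exact. Qed.

Section measurable_rV.
Context {d} {T : sigmaRingType d}.
Variable n : nat.

Definition rV_coord (i : 'I_n) (x : 'rV[T]_n) : T := x ord0 i.

Let rV_set0 : g_sigma_preimage rV_coord set0.
Proof. exact: sigma_algebra0. Qed.

Let rV_setC A : g_sigma_preimage rV_coord A -> g_sigma_preimage rV_coord (~` A).
Proof. exact: sigma_algebraC. Qed.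

Let rV_bigcup (F : _^nat) : (forall i, g_sigma_preimage rV_coord (F i)) ->
  g_sigma_preimage rV_coord (\bigcup_i (F i)).
Proof. exact: sigma_algebra_bigcup. Qed.

HB.instance Definition _ := @isMeasurable.Build (measure_rV_display d)
  'rV[T]_n (g_sigma_preimage rV_coord) rV_set0 rV_setC rV_bigcup.

Lemma measurable_rV_coord (i : 'I_n) : measurable_fun [set: 'rV[T]_n] (rV_coord i).
Proof.
move=> _ Y mY; rewrite setTI; apply: sub_sigma_algebra => /=.
rewrite -bigcup_seq/=; exists i => /=; first by rewrite mem_index_enum.
by exists Y => //; rewrite setTI.
Qed.

End measurable_rV.

Lemma measurable_fun_rVP d1 d2 (T1 : measurableType d1) (T2 : measurableType d2)
    n (f : T1 -> 'rV[T2]_n) :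
  measurable_fun [set: T1] f <->
  forall i, measurable_fun [set: T1] (fun x => f x ord0 i).
Proof.
split=> [mf i|mf].
  exact: (measurableT_comp (measurable_rV_coord i) mf).
move=> _ A mA; rewrite setTI.
suff : g_sigma_preimage (@rV_coord _ T2 n)
    `<=` [set B | measurable (f @^-1` B)] by exact.
apply: smallest_sub.
  split => /=.
  - by rewrite preimage_set0.
  - by move=> B mB; rewrite setTD preimage_setC; exact: measurableC.
  - by move=> B mB; rewrite preimage_bigcup; exact: bigcup_measurable.
rewrite -bigcup_seq => B [i _] [C mC <-] /=; rewrite setTI.
by have := mf i measurableT C mC; rewrite setTI.
Qed.

Section lebesgue_rV.
Variable R : realType.

Definition rV_cons n (x : R * 'rV[R]_n) : 'rV[R]_n.+1 :=
  \row_i oapp (fun j => x.2 ord0 j) x.1 (unlift ord0 i).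

Lemma measurable_rV_cons n : measurable_fun [set: R * 'rV[R]_n] (@rV_cons n).
Proof.
apply/measurable_fun_rVP => i; rewrite /rV_cons.
under eq_fun do rewrite mxE.
case: (unlift ord0 i) => [j|] /=; last exact: measurable_fst.
exact: (measurableT_comp (measurable_rV_coord j) measurable_snd).
Qed.

Section step.
Variables (n : nat) (mu : {sigma_finite_measure set 'rV[R]_n -> \bar R}).

Definition lebesgue_cons : set 'rV[R]_n.+1 -> \bar R :=
  pushforward (@lebesgue_measure R \x mu)%E (@rV_cons n).

Let lebesgue_cons0 : lebesgue_cons set0 = 0%E.
Proof. by rewrite /lebesgue_cons /pushforward preimage_set0 measure0. Qed.

Let lebesgue_cons_ge0 A : (0 <= lebesgue_cons A)%E.
Proof. by rewrite /lebesgue_cons /pushforward measure_ge0. Qed.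

Let measurable_preimage A :
  measurable A -> measurable (@rV_cons n @^-1` A).
Proof.
by move=> mA; rewrite -[X in measurable X]setTI; exact: measurable_rV_cons.
Qed.

Let lebesgue_cons_sigma_additive : semi_sigma_additive lebesgue_cons.
Proof.
move=> F mF tF mUF; rewrite /lebesgue_cons /pushforward preimage_bigcup.
apply: measure_semi_sigma_additive.
- by move=> k; exact: measurable_preimage.
- apply/trivIsetP => /= i j _ _ ij; rewrite -preimage_setI.
  by move/trivIsetP : tF => /(_ _ _ _ _ ij) ->//; rewrite preimage_set0.
- by rewrite -preimage_bigcup; exact: measurable_preimage.
Qed.

HB.instance Definition _ := isMeasure.Build _ _ _ lebesgue_cons
  lebesgue_cons0 lebesgue_cons_ge0 lebesgue_cons_sigma_additive.

Let lebesgue_cons_sigma_finite : sigma_finite setT lebesgue_cons.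
Proof.
have /sigma_finiteP[F [FT ndF Foo]] := sigma_finiteT (@lebesgue_measure R).
have /sigma_finiteP[G [GT ndG Goo]] := sigma_finiteT mu.
pose behead (x : 'rV[R]_n.+1) : R * 'rV[R]_n :=
  (x ord0 ord0, \row_j x ord0 (lift ord0 j)).
have beheadK x : rV_cons (behead x) = x.
  apply/rowP => i; rewrite mxE; case: unliftP => [j ->|->] //=.
  by rewrite mxE.
have consK : cancel (@rV_cons n) behead.
  move=> [a v]; rewrite /behead !mxE unlift_none /=; congr pair.
  by apply/rowP => j; rewrite !mxE liftK.
have mbehead : measurable_fun setT behead.
  apply: measurable_fun_pair => //=; first exact: measurable_rV_coord.
  apply/measurable_fun_rVP => i.
  under eq_fun do rewrite mxE.
  exact: measurable_rV_coord.
exists (fun k => behead @^-1` (F k `*` G k)).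
  rewrite -preimage_bigcup -[LHS](preimage_setT behead); congr (_ @^-1` _).
  apply/esym; rewrite -subTset => -[x y] _.
  have [k _ Fkx] : (\bigcup_k F k) x by rewrite -FT.
  have [l _ Gly] : (\bigcup_k G k) y by rewrite -GT.
  exists (maxn k l) => //; split => /=.
  - by move: x Fkx; exact/subsetPset/ndF/leq_maxl.
  - by move: y Gly; exact/subsetPset/ndG/leq_maxr.
move=> k; have [mF ?] := Foo k; have [mG ?] := Goo k; split.
  by rewrite -[X in measurable X]setTI; apply: mbehead => //; exact: measurableX.
rewrite /lebesgue_cons /pushforward -comp_preimage.
rewrite (_ : behead \o _ = id); last by apply/funext => x /=; rewrite consK.
by rewrite preimage_id product_measure1E// lte_mul_pinfty// ge0_fin_numE.
Qed.

HB.instance Definition _ := Measure_isSigmaFinite.Build _ _ _ lebesgue_cons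
  lebesgue_cons_sigma_finite.

End step.

Fixpoint lebesgue_rV n : {sigma_finite_measure set 'rV[R]_n -> \bar R} :=
  match n with
  | 0 => \d_(0 : 'rV[R]_0)
  | n'.+1 => lebesgue_cons (lebesgue_rV n')
  end.

End lebesgue_rV.

Lemma lebesgue_rV_box (R : realType) n (A : 'I_n -> set R) :
  (forall i, measurable (A i)) ->
  lebesgue_rV R n [set x | forall i, A i (x ord0 i)] =
  (\prod_(i < n) lebesgue_measure (A i))%E.
Proof.
elim: n A => [|n IH] A mA.
  rewrite big_ord0 /= diracE mem_set//=; by case.
rewrite big_ord_recl -IH// /= /lebesgue_cons /pushforward.
rewrite -product_measure1E//; last first.
  rewrite [X in measurable X](_ : _ =
      \bigcap_(i : 'I_n) (@rV_coord _ R n i @^-1` A (lift ord0 i))).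
    apply: fin_bigcap_measurable => // i _.
    by rewrite -[X in measurable X]setTI; exact: measurable_rV_coord.
  by apply/seteqP; split=> x /= h i; [move=> _|]; exact: h.
  exact: mA.
congr (_ _); apply/seteqP; split=> -[a v] /=.
  move=> h; split; first by have := h ord0; rewrite mxE unlift_none.
  by move=> i; have := h (lift ord0 i); rewrite mxE liftK.
by move=> [h0 h] i; rewrite mxE; case: unliftP => [j ->|->] /=.
Qed.

Section euclidean.
Variables (R : realType) (d : nat).
Implicit Types (x : 'rV[R]_d) (A : set 'rV[R]_d).

(* The library norm `|x| on row vectors is the sup norm. *)
Definition enorm x : R := Num.sqrt (\sum_(i < d) x ord0 i ^+ 2).

Definition dist_to x A : R := inf [set enorm (x - y) | y in A].

Definition gradient (f : 'rV[R]_d -> R) x : 'rV[R]_d :=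
  \row_(i < d) 'D_(delta_mx ord0 i) f x.

Definition is_density (p : 'rV[R]_d -> R) : Prop :=
  [/\ measurable_fun setT p,
      forall u, 0 <= p u
    & (\int[lebesgue_rV R d]_u (p u)%:E = 1)%E].

End euclidean.

Section diffusion.
Variables (R : realType) (d : nat) (I : finType).
Variables (w : I -> R) (p : I -> 'rV[R]_d -> R).
Implicit Types (t : R) (x z : 'rV[R]_d).

Definition ou_scale t : R := expR (- t).

Definition ou_std t : R := Num.sqrt (1 - ou_scale t ^+ 2).

Definition gauss_kernel t z : R :=
  (Num.sqrt (2 * pi) * ou_std t) ^- d *
  expR (- (enorm z ^+ 2 / (2 * ou_std t ^+ 2))).

Definition noised_component t (eta : I) x : R :=
  \int[lebesgue_rV R d]_u (p eta u * gauss_kernel t (x - ou_scale t *: u)).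

Definition noised_mixture t x : R :=
  \sum_(eta : I) w eta * noised_component t eta x.

Definition posterior t (eta0 : I) x : R :=
  w eta0 * noised_component t eta0 x / noised_mixture t x.

Definition guided_drift (T gamma : R) (eta0 : I) t x : 'rV[R]_d :=
  x + 2 *: gradient (fun y => ln (noised_mixture (T - t) y)) x
    + (2 * gamma) *: gradient (fun y => ln (posterior (T - t) eta0 y)) x.

End diffusion.

Section sde.
Context (R : realType) (d : nat).
Context (disp : measure_display) (Omega : measurableType disp).
Variable P : probability Omega R.
Implicit Types (F : R -> set (set Omega)) (B X : R -> Omega -> 'rV[R]_d).

Definition filtration F : Prop :=
  (forall t, 0 <= t -> sigma_algebra setT (F t) /\ F t `<=` measurable) /\
  (forall s t, 0 <= s -> s <= t -> F s `<=` F t).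

Definition adapted (D : set R) F X : Prop :=
  forall t, D t -> preimage_set_system setT (X t) measurable `<=` F t.

Definition increment X s t omega : 'rV[R]_d := X t omega - X s omega.

Definition brownian_motion F B : Prop :=
  [/\ adapted `[0, +oo[ F B,
      {ae P, forall omega, B 0 omega = 0},
      {ae P, forall omega, {within `[0, +oo[, continuous (B ^~ omega)}},
      forall s t, 0 <= s -> s < t ->
        forall (E : set Omega) (A : set 'rV[R]_d), F s E -> measurable A ->
        P (E `&` increment B s t @^-1` A) = (P E * P (increment B s t @^-1` A))%E
    & (* the increment has law N(0, (t - s) Id): its coordinates are
         independent centred Gaussians of standard deviation sqrt (t - s) *)
      forall s t, 0 <= s -> s < t ->
        forall A : 'I_d -> set R, (forall i, measurable (A i)) ->
        P [set omega | forall i, A i (increment B s t omega ord0 i)] =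
        (\prod_(i < d) normal_prob 0 (Num.sqrt (t - s)) (A i))%E].

(* X solves dX_t = b(t, X_t) dt + c dB_t on [0, T[ with X_0 = x0. The diffusion
   coefficient c is constant, so the stochastic integral of c up to time t is
   c *: B t (recall B 0 = 0) and the equation is read path by path. *)
Definition sde_solution F B (T : R) (b : R -> 'rV[R]_d -> 'rV[R]_d) (c : R)
    (x0 : 'rV[R]_d) X : Prop :=
  [/\ adapted `[0, T[ F X,
      {ae P, forall omega, {within `[0, T[, continuous (X ^~ omega)}}
    & {ae P, forall omega, forall t, 0 <= t < T -> forall i : 'I_d,
        lebesgue_measure.-integrable `[0, t]
          (fun s => (b s (X s omega) ord0 i)%:E) /\
        X t omega ord0 i = x0 ord0 i
          + \int[lebesgue_measure]_(s in `[0, t]) b s (X s omega) ord0 i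
          + c * B t omega ord0 i}].

End sde.

(* Main.v *)
Require Import Defs.
From HB Require Import structures.
From mathcomp Require Import all_boot all_order all_algebra.
From mathcomp Require Import all_classical all_reals all_analysis.
From mathcomp Require Import measurable_realfun ring lra.

Set Implicit Arguments.
Unset Strict Implicit.
Unset Printing Implicit Defensive.

Import Order.TTheory GRing.Theory Num.Theory.
Import numFieldNormedType.Exports.

Local Open Scope classical_set_scope.
Local Open Scope ring_scope.

(* The noise is additive, so the statement is deterministic, path by path.
   Remove the noise by W t = X t - sqrt 2 (B t - B T): as B is continuous at T,
   W has the same limit behaviour as X, and W' is the drift. By Tweedie's formula
   the drift at remaining time tau = T - t is x + (2 / sigma^2) (lambda m - x),
   with m = gamma m0 + (1 - gamma) m1, where m0 and m1 are the posterior means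
   of the clean point under p_eta0 and under the full mixture, and
   2 / sigma^2 >= 1 / tau.

   Let y = x / lambda and let pr be the projection onto K = K_eta0. As m0 lies in
   K, <y - pr y, m0 - pr y> <= 0. Guidance does not hurt:
   <y - pr y, m0 - m1> <= O(tau), because a point u of another component with
   a = <y - pr y, pr y - u> > 0 has
   |y - u|^2 = |y - pr y|^2 + 2 a + |u - pr y|^2, hence a kernel value times a of
   at most theta exp (- (|y - pr y|^2 + delta^2) / (2 theta)), with
   theta = (sigma / lambda)^2 and delta the distance between the components,
   while convexity of K and the lower bound on p_eta0 give the mixture at least a
   constant times the same exponential.

   So g = dist (W, K)^2 satisfies g' <= - g / (T - t) wherever g >= eps and t is
   close to T, which forces g <= eps eventually. The same argument with K replaced
   by {0} first bounds the path. *)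

(** * Dot product and projection onto a convex set *)

Section dot_product.
Context {R : realType} {d : nat}.
Implicit Types (u v x y z : 'rV[R]_d).

Definition dot u v : R := \sum_(i < d) u ord0 i * v ord0 i.

Lemma dotC u v : dot u v = dot v u.
Proof. by apply: eq_bigr => i _; rewrite mulrC. Qed.

Lemma dotDl u v z : dot (u + v) z = dot u z + dot v z.
Proof. by rewrite -big_split; apply: eq_bigr => i _; rewrite mxE mulrDl. Qed.

Lemma dotZl (a : R) u v : dot (a *: u) v = a * dot u v.
Proof. by rewrite /dot mulr_sumr; apply: eq_bigr => i _; rewrite mxE mulrA. Qed.

Lemma dotNl u v : dot (- u) v = - dot u v.
Proof. by rewrite -scaleN1r dotZl mulN1r. Qed.

Lemma dotBl u v z : dot (u - v) z = dot u z - dot v z.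
Proof. by rewrite dotDl dotNl. Qed.

Lemma dotDr u v z : dot z (u + v) = dot z u + dot z v.
Proof. by rewrite !(dotC z) dotDl. Qed.

Lemma dotZr (a : R) u v : dot u (a *: v) = a * dot u v.
Proof. by rewrite !(dotC u) dotZl. Qed.

Lemma dotNr u v : dot u (- v) = - dot u v.
Proof. by rewrite !(dotC u) dotNl. Qed.

Lemma dotBr u v z : dot z (u - v) = dot z u - dot z v.
Proof. by rewrite !(dotC z) dotBl. Qed.

Definition dotE := (dotDl, dotBl, dotZl, dotNl, dotDr, dotBr, dotZr, dotNr).

Lemma dot_ge0 u : 0 <= dot u u.
Proof. by apply: sumr_ge0 => i _; rewrite -expr2 sqr_ge0. Qed.

Lemma dot_sqrB u v : dot (u - v) (u - v) = dot u u - 2 * dot u v + dot v v.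
Proof. by rewrite !dotE (dotC v u); ring. Qed.

Lemma dot_sqrD u v : dot (u + v) (u + v) = dot u u + 2 * dot u v + dot v v.
Proof. by rewrite !dotE (dotC v u); ring. Qed.

Lemma enorm_sqr u : enorm u ^+ 2 = dot u u.
Proof.
rewrite /enorm sqr_sqrtr; last by apply: sumr_ge0 => i _; rewrite sqr_ge0.
by apply: eq_bigr => i _; rewrite expr2.
Qed.

Lemma enorm_dot u : enorm u = Num.sqrt (dot u u).
Proof. by rewrite -enorm_sqr sqrtr_sqr ger0_norm// sqrtr_ge0. Qed.

Lemma coord_le_norm u i : `|u ord0 i| <= `|u|.
Proof.
rewrite /Num.Def.normr/= mx_normrE.
exact: (le_bigmax_cond _ (fun ij : 'I_1 * 'I_d => `|u ij.1 ij.2|) (j := (ord0, i))).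
Qed.

Lemma norm_le_coord u (c : R) :
  0 <= c -> (forall i, `|u ord0 i| <= c) -> `|u| <= c.
Proof.
move=> c0 h; rewrite /Num.Def.normr/= mx_normrE.
by apply/bigmax_leP; split => // -[j i] _ /=; rewrite (ord1 j).
Qed.

Lemma dot_norm_le u v : `|dot u v| <= d%:R * (`|u| * `|v|).
Proof.
apply: (le_trans (ler_norm_sum _ _ _)).
rewrite mulr_natl -[X in _ *+ X]card_ord -sumr_const.
by apply: ler_sum => i _; rewrite normrM ler_pM// coord_le_norm.
Qed.

Lemma dot_le_norm u v : dot u v <= d%:R * (`|u| * `|v|).
Proof. exact: le_trans (ler_norm _) (dot_norm_le _ _). Qed.

Lemma sqr_norm_le_dot u : `|u| ^+ 2 <= dot u u.
Proof.
rewrite -[leRHS]sqr_sqrtr ?dot_ge0// ler_pXn2r ?nnegrE ?sqrtr_ge0//.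
apply: norm_le_coord; first exact: sqrtr_ge0.
move=> i; rewrite -(ler_pXn2r (n := 2)) ?nnegrE ?sqrtr_ge0// sqr_sqrtr ?dot_ge0//.
rewrite real_normK ?num_real// /dot (bigD1 i)//= expr2 lerDl.
by apply: sumr_ge0 => j _; rewrite -expr2 sqr_ge0.
Qed.

(** [dot] is Euclidean while the bars denote the sup norm. Passing between them costs a factor
    [sqrt d]; the cruder [d%:R] keeps square roots out of the constants below. *)
Lemma norm_le_of_dot u v : dot u u <= dot v v -> `|u| <= d%:R * `|v|.
Proof.
move=> uv; have dv0 : 0 <= d%:R * `|v| by rewrite mulr_ge0.
rewrite -(ler_pXn2r (n := 2)) ?nnegrE//.
apply: le_trans (sqr_norm_le_dot u) _; apply: le_trans uv _.
apply: le_trans (dot_le_norm v v) _.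
rewrite exprMn -expr2 ler_wpM2r ?sqr_ge0//.
by rewrite -natrX ler_nat; case: (d) => // k; rewrite expnS leq_pmulr// expn_gt0.
Qed.

Lemma continuous_sqr_dist x : continuous (fun y => dot (x - y) (x - y)).
Proof.
pose F (i : 'I_d) : 'rV[R]_d -> R :=
  (fun a => (x ord0 i - a) * (x ord0 i - a)) \o (fun y => y ord0 i).
have -> : (fun y => dot (x - y) (x - y)) = fun y => \sum_(i < d) F i y.
  by apply/funext => y; apply: eq_bigr => i _; rewrite /F /= !mxE.
apply: continuous_big => [|i _ y]; first exact: add_continuous.
apply: continuous_comp; first exact: coord_continuous.
have cB : {for y ord0 i, continuous (fun a : R => x ord0 i - a)}.
  by apply: continuousB; [exact: cst_continuous|exact: cvg_id].
exact: continuousM.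
Qed.

(** The nearest point is encoded by its variational inequality rather than by minimality: the
    residual [x - pr x] makes an obtuse angle with every direction into [K]. This linear form can be
    averaged over a posterior. *)
Definition is_projection (K : set 'rV[R]_d) (pr : 'rV[R]_d -> 'rV[R]_d) :=
  forall x, K (pr x) /\ forall u, K u -> dot (x - pr x) (u - pr x) <= 0.

Lemma convex_setP (K : set 'rV[R]_d) x y (s : R) :
  convex_set K -> 0 <= s <= 1 -> K x -> K y -> K (x + s *: (y - x)).
Proof.
move=> cK /andP[s0 s1] Kx Ky.
have s0' : 0 <= 1 - s by rewrite subr_ge0.
have s1' : 1 - s <= 1 by rewrite lerBlDr lerDl.
have := cK x y (Itv01 s0' s1') (mem_set Kx) (mem_set Ky).
move=> /set_mem; congr K.
rewrite /conv/= unstable.onemK scalerBr scalerBl scale1r.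
by rewrite -!addrA [- _ + _]addrC.
Qed.

(** A nearest point [y] exists by compactness. If some [u] in [K] made an acute angle at [y],
    sliding from [y] towards [u] would come closer to [x]. *)
Lemma projection_exists (K : set 'rV[R]_d) :
  compact K -> convex_set K -> K !=set0 -> exists pr, is_projection K pr.
Proof.
move=> cK cvK K0.
suff h : forall x, exists y, K y /\ forall u, K u -> dot (x - y) (u - y) <= 0.
  by have [pr prP] := choice h; exists pr.
move=> x.
have [y yK ymin] := compact_EVT_min K0 cK
  (continuous_subspaceT (@continuous_sqr_dist x)).
move/set_mem : yK => Ky; exists y; split => // u Ku.
rewrite leNgt; apply/negP => pos.
set a := dot (x - y) (u - y) in pos.
set b := dot (u - y) (u - y).
have b0 : 0 <= b by exact: dot_ge0.
(* From [s * (a + b) = a] follows [s * b < a], so the change [- 2 * s * a + s ^+ 2 * b] of the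
   squared distance is negative; the summand [a] in the denominator also ensures [s <= 1], hence a
   point of [K]. *)
pose s := a / (a + b).
have ab0 : 0 < a + b by lra.
have s0 : 0 < s by rewrite divr_gt0.
have s1 : s <= 1 by rewrite ler_pdivrMr// mul1r; lra.
have Kz : K (y + s *: (u - y)) by apply: convex_setP => //; rewrite ltW.
have := ymin _ (mem_set Kz).
rewrite opprD addrA [leRHS]dot_sqrB !dotZr dotZl -/a -/b.
have sab : s * (a + b) = a by rewrite mulfVK// gt_eqF.
nra.
Qed.

Section projection.
Context {K : set 'rV[R]_d} {pr : 'rV[R]_d -> 'rV[R]_d}.
Hypothesis prP : is_projection K pr.

Lemma projection_min x u :
  K u -> dot (x - pr x) (x - pr x) <= dot (x - u) (x - u).
Proof.
move=> /(prP x).2 h.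
have -> : x - u = (x - pr x) - (u - pr x) by rewrite opprB addrA subrK.
rewrite [leRHS]dot_sqrB; have := dot_ge0 (u - pr x); lra.
Qed.

(** Adding the variational inequalities at [x] and [y] bounds the squared length of [pr x - pr y] by
    its product with [x - y]; the square of the difference of these two vectors then replaces
    Cauchy-Schwarz. *)
Lemma projection_lipschitz x y : `|pr x - pr y| <= d%:R * `|x - y|.
Proof.
apply: norm_le_of_dot.
have hx := (prP x).2 _ (prP y).1.
have hy := (prP y).2 _ (prP x).1.
have := dot_ge0 ((x - y) - (pr x - pr y)).
rewrite dot_sqrB.
have : dot (x - y) (pr x - pr y) = dot (pr x - pr y) (pr x - pr y)
    - dot (x - pr x) (pr y - pr x) - dot (y - pr y) (pr x - pr y).
  by rewrite !dotE (dotC (pr y) (pr x)); ring.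
lra.
Qed.

End projection.

End dot_product.

(** * A barrier argument *)

Section barrier.
Context {R : realType}.

Definition dist_continuous (V : normedModType R) (a b : R) (f : R -> V) :=
  forall s e : R, a <= s < b -> 0 < e ->
  exists2 h, 0 < h & forall r, a <= r < b -> `|r - s| < h -> `|f r - f s| < e.

(** The step hypothesis is a discrete form of [g' <= - g / (T - t)], whose solutions are the
    multiples of [T - t]. The proof is a continuous induction: at the last time [s] before [t1] with
    [g] below the barrier [phi], [g] cannot start to exceed it. *)
Lemma barrier (g : R -> R) (s0 T eps : R) :
  0 <= eps ->
  dist_continuous s0 T g ->
  (forall s, s0 <= s < T -> eps <= g s ->
    exists2 h0, 0 < h0 & forall h, 0 < h < h0 -> s + h < T ->
      g (s + h) <= g s * (T - s - h) / (T - s)) ->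
  forall t, s0 <= t < T ->
    g t <= Num.max eps (g s0 * (T - t) / (T - s0)).
Proof.
move=> e0 cg step t1 /andP[s0t1 t1T].
pose C := g s0 / (T - s0).
have s0T : 0 < T - s0 by lra.
rewrite mulrAC -/C.
pose phi t := Num.max eps (C * (T - t)).
have phi_eps t : eps <= phi t by rewrite le_max lexx.
have phi_C t : C * (T - t) <= phi t by rewrite le_max lexx orbT.
rewrite -/(phi t1) leNgt; apply/negP => gt1.
pose S := [set r | s0 <= r <= t1 /\ g r <= phi r].
have Ss0 : S s0.
  split; first by rewrite lexx.
  by rewrite le_max /C mulfVK ?lexx ?orbT// gt_eqF.
have ubS : ubound S t1 by move=> r [/andP[]].
have supS : has_sup S by split; [exists s0|exists t1].
pose s := sup S.
have s0s : s0 <= s by exact: sup_upper_bound.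
have st1 : s <= t1 by apply: ge_sup => //; exists s0.
have sT : s0 <= s < T by rewrite s0s (le_lt_trans st1).
(* The supremum is attained. Otherwise [g] exceeds [phi] by [2 * e] at [s]; times of [S] close to
   [s] on the left change [g] by less than [e], and raise [phi] by at most [e] because its slope is
   at most the absolute value of [C]. *)
have Ss : g s <= phi s.
  rewrite leNgt; apply/negP => phis.
  pose e := (g s - phi s) / 2.
  have e_gt0 : 0 < e by rewrite divr_gt0// subr_gt0.
  have [h0 h00 hg] := cg s e sT e_gt0.
  pose k := e / (1 + `|C|).
  have C1 : 0 < 1 + `|C| by rewrite ltr_pwDl.
  have k0 : 0 < k by rewrite divr_gt0.
  have hk : 0 < Num.min h0 k by rewrite lt_min h00.
  have [r Sr rs] := sup_adherent hk supS.
  have rles : r <= s by exact: sup_upper_bound.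
  have [/andP[s0r rt1] gr] := Sr.
  rewrite -/s ltrBlDr -ltrBlDl in rs.
  have rT : s0 <= r < T by rewrite s0r (le_lt_trans rt1).
  have [rs1 rs2] : s - r < h0 /\ s - r < k.
    by apply/andP; rewrite -lt_min ltrBlDr -ltrBlDl; lra.
  have := hg r rT; rewrite distrC ger0_norm ?subr_ge0// => /(_ rs1).
  rewrite ltr_norml => /andP[hgr _].
  have : phi r <= phi s + e.
    rewrite /phi ge_max; apply/andP; split.
      by have := phi_eps s; rewrite -/(phi s); lra.
    have -> : C * (T - r) = C * (T - s) + C * (s - r) by ring.
    apply: lerD => //; apply: le_trans (ler_norm _) _.
    rewrite normrM (ger0_norm (_ : 0 <= s - r)) ?subr_ge0//.
    have : (1 + `|C|) * (s - r) <= (1 + `|C|) * k by rewrite ler_pM2l// ltW.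
    rewrite /k mulrCA mulfV ?gt_eqF// mulr1.
    have : 0 <= s - r by rewrite subr_ge0.
    lra.
  by have : 2 * e = g s - phi s; [rewrite /e; field|]; lra.
have {st1}st1 : s < t1.
  by rewrite lt_neqAle st1 andbT; apply/eqP => E; rewrite E leNgt gt1 in Ss.
have gt_phi r : s < r <= t1 -> phi r < g r.
  move=> /andP[sr rt1]; rewrite ltNge; apply/negP => gr.
  have : r <= s.
    apply: sup_upper_bound => //; split => //.
    by rewrite rt1 andbT (le_trans s0s (ltW sr)).
  by rewrite leNgt sr.
(* Above level [eps] the step hypothesis keeps [g] under the barrier a little beyond [s]; below that
   level continuity keeps [g] under [eps]. Both contradict the choice of [s]. *)
have [gs|gs] := leP eps (g s).
  have [h0 h00 hg] := step s sT gs.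
  pose h := Num.min (h0 / 2) (t1 - s).
  have h_gt0 : 0 < h by rewrite lt_min divr_gt0//= subr_gt0.
  have h1 : h <= h0 / 2 by rewrite ge_min lexx.
  have h2 : h <= t1 - s by rewrite ge_min lexx orbT.
  have /hg : 0 < h < h0 by rewrite h_gt0/=; lra.
  have shT : s + h < T by lra.
  move=> /(_ shT); apply/negP; rewrite -ltNge.
  have shI : s < s + h <= t1 by rewrite ltrDl h_gt0/=; lra.
  apply: le_lt_trans (gt_phi _ shI).
  have Ts : 0 < T - s by lra.
  rewrite ler_pdivrMr//.
  apply: (@le_trans _ _ (phi s * (T - s - h))).
    by rewrite ler_wpM2r//; lra.
  (* On the linear piece, multiplying by [(T - s - h) / (T - s)] moves along the barrier exactly; on
     the constant piece the factor only decreases the value. *)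
  rewrite {1}/phi; case: (leP eps (C * (T - s))) => _.
    rewrite mulrAC; apply: ler_wpM2r; first exact: ltW.
    by apply: le_trans (phi_C _); rewrite -addrA opprD.
  by apply: ler_pM => //; lra.
have {}e0 : 0 < eps - g s by rewrite subr_gt0.
have [h0 h00 hg] := cg s _ sT e0.
pose r := Num.min (s + h0 / 2) t1.
have sr : s < r by rewrite lt_min st1 andbT ltrDl divr_gt0.
have rt1 : r <= t1 by rewrite ge_min lexx orbT.
have rs : r <= s + h0 / 2 by rewrite ge_min lexx.
have rT : s0 <= r < T by rewrite (le_trans s0s (ltW sr)) (le_lt_trans rt1).
have := hg r rT; rewrite ger0_norm; last by rewrite subr_ge0 ltW.
have rh : r - s < h0 by lra.
move=> /(_ rh); rewrite ltr_norml => /andP[_ ].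
have : phi r < g r by apply: gt_phi; rewrite sr.
have := phi_eps r; lra.
Qed.

Context {d : nat}.
Implicit Types (W D : R -> 'rV[R]_d) (K : set 'rV[R]_d).

Lemma dot_sqr_sub_le (u v : 'rV[R]_d) :
  `|dot u u - dot v v| <= d%:R * (`|u - v| * (`|u - v| + 2 * `|v|)).
Proof.
have -> : dot u u - dot v v = dot (u - v) ((u - v) + 2 *: v).
  by rewrite !dotE (dotC v u); ring.
apply: le_trans (dot_norm_le _ _) _.
rewrite !ler_wpM2l//; apply: le_trans (ler_normD _ _) _.
by rewrite normrZ ger0_norm.
Qed.

Definition sqr_dist_proj (pr : 'rV[R]_d -> 'rV[R]_d) (x : 'rV[R]_d) : R :=
  dot (x - pr x) (x - pr x).

Lemma proj_residual_lipschitz K pr (x y : 'rV[R]_d) : is_projection K pr ->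
  `|(x - pr x) - (y - pr y)| <= (1 + d%:R) * `|x - y|.
Proof.
move=> prP; have -> : (x - pr x) - (y - pr y) = (x - y) - (pr x - pr y).
  by rewrite !opprD !opprK addrACA.
apply: le_trans (ler_normB _ _) _; rewrite mulrDl mul1r lerD2l.
exact: projection_lipschitz prP _ _.
Qed.

Lemma sqr_dist_proj_sub_le K pr (x y : 'rV[R]_d) : is_projection K pr ->
  `|x - y| <= 1 ->
  `|sqr_dist_proj pr x - sqr_dist_proj pr y| <=
    d%:R * ((1 + d%:R) * (1 + d%:R + 2 * `|y - pr y|)) * `|x - y|.
Proof.
move=> prP xy1; apply: le_trans (dot_sqr_sub_le _ _) _.
rewrite -!mulrA ler_wpM2l//.
have h := proj_residual_lipschitz x y prP.
set a := `|_ - _| in h *.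
have d0 : 0 <= d%:R :> R by [].
have a0 : 0 <= a by rewrite /a.
have hxy : (1 + d%:R) * `|x - y| <= 1 + d%:R by rewrite ger_pMr//; lra.
rewrite mulrA mulrAC; apply: ler_pM => //; rewrite ?addr_ge0//.
by rewrite lerD2r (le_trans h).
Qed.

Lemma delta_dot (i : 'I_d) (v : 'rV[R]_d) : dot (delta_mx ord0 i) v = v ord0 i.
Proof.
rewrite /dot (bigD1 i)//= mxE !eqxx mul1r big1 ?addr0// => j ji.
by rewrite mxE (negbTE ji) andbF mul0r.
Qed.

(** * Decay of the squared distance to a convex set along a path *)

Section lyapunov.
Variables (W D : R -> 'rV[R]_d) (K : set 'rV[R]_d).
Variables (pr : 'rV[R]_d -> 'rV[R]_d) (s0 T : R).
Hypothesis prP : is_projection K pr.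
Hypothesis cW : dist_continuous s0 T W.
(** Integral form of [W' = D], tested against a fixed direction [v], since [D] stands for an
    integrable drift along the path. *)
Hypothesis incrW : forall s t v c, s0 <= s -> s <= t -> t < T ->
  (forall r, s <= r <= t -> dot v (D r) <= c) ->
  dot v (W t - W s) <= c * (t - s).

Lemma norm_incr_le s t L : s0 <= s -> s <= t -> t < T ->
  (forall r, s <= r <= t -> `|D r| <= L) -> `|W t - W s| <= L * (t - s).
Proof.
move=> s0s st tT DL.
have L0 : 0 <= L.
  by apply: le_trans (DL s _); rewrite ?lexx.
apply: norm_le_coord => [|i]; first by rewrite mulr_ge0// subr_ge0.
rewrite ler_norml -!(delta_dot i) -mulNr; apply/andP; split; last first.
  apply: incrW => // r /DL; apply: le_trans.
  by rewrite delta_dot (le_trans (ler_norm _))// coord_le_norm.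
rewrite mulNr lerNl -dotNl; apply: incrW => // r /DL; apply: le_trans.
by rewrite dotNl delta_dot -normrN (le_trans (ler_norm _))// ?normrN coord_le_norm.
Qed.

(** The residual is frozen at time [s], so the first-order change of the squared distance is at most
    [- 14 / 10 * g / (T - s)] times [h]. The barrier asks only for the coefficient 1; the spare
    [4 / 10] absorbs the quadratic remainder. *)
Lemma lyapunov eps : 0 < eps ->
  (forall s, s0 <= s < T -> eps <= sqr_dist_proj pr (W s) ->
    exists h0 L, 0 < h0 /\ forall r, s <= r -> r < s + h0 -> r < T ->
      dot (W s - pr (W s)) (D r) <=
        - (7 / 10 * (sqr_dist_proj pr (W s) / (T - s))) /\ `|D r| <= L) ->
  forall t, s0 <= t < T -> sqr_dist_proj pr (W t) <=
    Num.max eps (sqr_dist_proj pr (W s0) * (T - t) / (T - s0)).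
Proof.
move=> eps0 hD; apply: (barrier (g := fun s => sqr_dist_proj pr (W s))).
- exact: ltW.
- move=> s e sT e0 /=.
  set C := d%:R * ((1 + d%:R) * (1 + d%:R + 2 * `|W s - pr (W s)|)).
  have C0 : 0 <= C by rewrite /C !(mulr_ge0, addr_ge0).
  have C1 : 0 < 1 + C by rewrite ltr_pwDl.
  have k0 : 0 < Num.min 1 (e / (1 + C)) by rewrite lt_min ltr01 divr_gt0.
  have [h0 h00 hW] := cW sT k0.
  exists h0 => // r rT /(hW _ rT); rewrite lt_min => /andP[W1 W2].
  apply: le_lt_trans (sqr_dist_proj_sub_le prP (ltW W1)) _.
  rewrite -/C; rewrite ltr_pdivlMr// in W2.
  have : 0 <= `|W r - W s| by [].
  nra.
move=> s sT gs.
have [h0 [L [h00 hL]]] := hD s sT gs.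
have /andP[s0s s_T] := sT.
have Ts : 0 < T - s by lra.
set g := sqr_dist_proj _ _ in gs hL *.
have g0 : 0 < g by exact: lt_le_trans gs.
have C1 : 0 < 1 + d%:R * L ^+ 2 by rewrite ltr_pwDl// mulr_ge0// sqr_ge0.
(* This bound on [h] makes the remainder [d%:R * L ^+ 2 * h ^+ 2] at most
   [4 / 10 * g / (T - s) * h]. *)
exists (Num.min h0 (4 / 10 * (g / (T - s)) / (1 + d%:R * L ^+ 2))).
  by rewrite lt_min h00/= divr_gt0// mulr_gt0// divr_gt0.
move=> h /andP[h_gt0]; rewrite lt_min => /andP[hh0 hC] shT.
have sh : s <= s + h by rewrite lerDl ltW.
set u := W s - pr (W s).
set D' := W (s + h) - W s.
have nD : `|D'| <= L * h.
  have := @norm_incr_le s (s + h) L s0s sh shT.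
  rewrite -[s + h - s]addrAC subrr add0r; apply => r /andP[sr rsh].
  by have [||_] := hL r sr; lra.
have dD : dot u D' <= - (7 / 10 * (g / (T - s))) * h.
  have := @incrW s (s + h) u (- (7 / 10 * (g / (T - s)))) s0s sh shT.
  rewrite -[s + h - s]addrAC subrr add0r; apply => r /andP[sr rsh].
  by have [||+ _] := hL r sr; lra.
(* The old projection [pr (W s)] is a competitor at time [s + h], so the projection is never
   differentiated. *)
have : sqr_dist_proj pr (W (s + h)) <= g + 2 * dot u D' + dot D' D'.
  apply: le_trans (projection_min prP _ (prP (W s)).1) _.
  have -> : W (s + h) - pr (W s) = u + D' by rewrite /u /D' addrAC addrCA subrr addr0 addrC.
  by rewrite (dot_sqrD u D').
have DD : dot D' D' <= d%:R * L ^+ 2 * h ^+ 2.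
  apply: le_trans (dot_le_norm _ _) _.
  by rewrite -mulrA ler_wpM2l// -exprMn -expr2 ler_pXn2r ?nnegrE// (le_trans _ nD).
rewrite ltr_pdivlMr// in hC.
have -> : g * (T - s - h) / (T - s) = g - h * (g / (T - s)).
  by field; rewrite gt_eqF.
set q := g / (T - s) in hC dD *.
have : h * (h * (1 + d%:R * L ^+ 2)) <= h * (4 / 10 * q).
  by rewrite ler_pM2l// ltW.
have : 0 <= h ^+ 2 by exact: sqr_ge0.
rewrite expr2 in DD *.
nra.
Qed.

End lyapunov.
End barrier.

(** * Paths driven by an Ornstein-Uhlenbeck type drift *)

Section ou_bounds.
Context {R : realType}.
Implicit Types t : R.

Lemma ou_scale_gt0 t : 0 < ou_scale t.
Proof. exact: expR_gt0. Qed.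

Lemma ou_scale_lt1 t : 0 < t -> ou_scale t < 1.
Proof. by move=> t0; rewrite expR_lt1 oppr_lt0. Qed.

Lemma ou_scale_ge t : 1 - t <= ou_scale t.
Proof. exact: expR_ge1Dx. Qed.

Lemma ou_var_gt0 t : 0 < t -> 0 < 1 - ou_scale t ^+ 2.
Proof.
by move=> t0; rewrite subr_gt0 expr_lt1// ?ou_scale_lt1// ltW// ou_scale_gt0.
Qed.

Lemma ou_var_le t : 1 - ou_scale t ^+ 2 <= 2 * t.
Proof.
rewrite /ou_scale -expRM_natl mulrN; have := expR_ge1Dx (- (2 * t)); lra.
Qed.

Lemma ou_rate_ge t : 0 < t -> t^-1 <= 2 / (1 - ou_scale t ^+ 2).
Proof.
move=> t0; rewrite ler_pdivlMr ?ou_var_gt0// mulrC ler_pdivrMr//.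
exact: ou_var_le.
Qed.

(** From [expR t >= 1 + t], the scale is at most [1 / (1 + t)], so [1 - ou_scale t ^+ 2 >= 1 -
    ou_scale t >= t / (1 + t)]. This keeps the drift bounded away from the final time. *)
Lemma ou_rate_le t : 0 < t -> 2 / (1 - ou_scale t ^+ 2) <= 2 * (1 + t) / t.
Proof.
move=> t0; rewrite -mulrA ler_wpM2l// -[leRHS]invf_div lef_pV2 ?posrE; last 2 first.
- exact: ou_var_gt0.
- by rewrite divr_gt0// addr_gt0.
have l0 := ou_scale_gt0 t; have l1 := ou_scale_lt1 t0.
have : ou_scale t * (1 + t) <= 1.
  rewrite /ou_scale expRN mulrC ler_pdivrMr ?expR_gt0// mul1r.
  exact: expR_ge1Dx.
rewrite ler_pdivrMr ?addr_gt0//.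
have : 0 < ou_scale t * (1 - ou_scale t) by rewrite mulr_gt0// subr_gt0.
nra.
Qed.

Lemma ou_scaleV_le t : 0 < t <= 1 / 2 -> (ou_scale t)^-1 <= 1 + 2 * t.
Proof.
move=> /andP[t0 t1]; have l := ou_scale_ge t; have l0 := ou_scale_gt0 t.
rewrite -[leLHS]mul1r ler_pdivrMr//; nra.
Qed.

End ou_bounds.

(** * Boundedness and convergence of a path pulled towards a moving bounded target *)

Section path.
Context {R : realType} {d : nat}.
Variables (T M : R) (X n mt : R -> 'rV[R]_d).

(** The guided drift after Tweedie's formula, with the combined posterior mean abstracted into a
    function [mt] of time; [n] is the noise and [W] the path without it. *)
Definition ou_drift s : 'rV[R]_d :=
  X s + (2 / (1 - ou_scale (T - s) ^+ 2)) *: (ou_scale (T - s) *: mt s - X s).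

Let W s := X s - n s.

Hypothesis T0 : 0 < T.
Hypothesis cX : dist_continuous 0 T X.
Hypothesis cn : dist_continuous 0 T n.
Hypothesis n0 : forall e, 0 < e ->
  exists2 s0, 0 <= s0 < T & forall r, s0 <= r < T -> `|n r| <= e.
Hypothesis incrW : forall s t v c, 0 <= s -> s <= t -> t < T ->
  (forall r, s <= r <= t -> dot v (ou_drift r) <= c) ->
  dot v (W t - W s) <= c * (t - s).
Hypothesis mtM : forall s, 0 <= s < T -> `|mt s| <= M.

Let cW : dist_continuous 0 T W.
Proof.
move=> s e sT e0; have e2 : 0 < e / 2 by rewrite divr_gt0.
have [h1 h10 H1] := cX sT e2; have [h2 h20 H2] := cn sT e2.
exists (Num.min h1 h2); first by rewrite lt_min h10.
move=> r rT; rewrite lt_min => /andP[/(H1 _ rT) rX /(H2 _ rT) rn].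
have -> : W r - W s = (X r - X s) - (n r - n s).
  by rewrite /W !opprD !opprK addrACA.
by apply: le_lt_trans (ler_normB _ _) _; lra.
Qed.

(** The free term [X s] is absorbed into the bracket, so that the singular rate [2 / sigma^2]
    multiplies the whole drift; the coefficient of [X s] moves from 1 to [1 - sigma^2 / 2]. *)
Let ou_driftE s : 0 <= s < T -> ou_drift s =
  (2 / (1 - ou_scale (T - s) ^+ 2)) *:
    (ou_scale (T - s) *: mt s - (1 - (1 - ou_scale (T - s) ^+ 2) / 2) *: X s).
Proof.
move=> /andP[s0 sT]; rewrite /ou_drift.
set v := 1 - _ ^+ 2.
have v0 : v != 0 by rewrite gt_eqF// ou_var_gt0// subr_gt0.
rewrite [in RHS]scalerBl opprB scale1r [in RHS]addrC -addrA [RHS]scalerDr.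
rewrite scalerA (_ : 2 / v * (v / 2) = 1) ?scale1r; last by field.
by rewrite [- X s + _]addrC.
Qed.

Let local_control s e : 0 <= s < T -> 0 < e ->
  exists h0 L, 0 < h0 /\ forall r, s <= r -> r < s + h0 -> r < T ->
    `|W r - W s| < e /\ `|ou_drift r| <= L.
Proof.
move=> sT e0; have /andP[s0 s_T] := sT.
have [h1 h10 H1] := cW sT e0; have [h2 h20 H2] := cX sT ltr01.
(* Using at most half of the remaining time keeps [T - r >= (T - s) / 2], which bounds the rate in
   [L]. *)
have Ts : 0 < (T - s) / 2 by rewrite divr_gt0// subr_gt0.
pose L := (1 + `|X s|) + 2 * (1 + T) / ((T - s) / 2) * (M + (1 + `|X s|)).
exists (Num.min (Num.min h1 h2) ((T - s) / 2)), L; split.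
  by rewrite !lt_min h10 h20.
move=> r sr rs rT; have rT' : 0 <= r < T by rewrite (le_trans s0).
have rs0 : 0 <= r - s by rewrite subr_ge0.
have : r - s < Num.min (Num.min h1 h2) ((T - s) / 2) by lra.
rewrite -{1}(ger0_norm rs0) !lt_min => /andP[/andP[r1 r2] r3].
split; first exact: H1.
have Xr : `|X r| <= 1 + `|X s|.
  rewrite -[X r](subrK (X s)); apply: le_trans (ler_normD _ _) _.
  by rewrite lerD2r ltW// H2.
have Tr : 0 < T - r by rewrite subr_gt0.
apply: le_trans (ler_normD _ _) _; apply: lerD => //.
have l1 := ou_scale_lt1 Tr; have l0 := ou_scale_gt0 (T - r).
have a0 : 0 < 2 / (1 - ou_scale (T - r) ^+ 2) by rewrite divr_gt0// ou_var_gt0.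
rewrite normrZ (gtr0_norm a0); apply: ler_pM => //; first exact: ltW.
  apply: le_trans (ou_rate_le Tr) _.
  have Tr2 : (T - s) / 2 <= T - r by rewrite (ger0_norm rs0) in r3; lra.
  apply: ler_pM; [lra|by rewrite invr_ge0 ltW|lra|].
  by rewrite lef_pV2// posrE.
apply: le_trans (ler_normB _ _) _; apply: lerD => //.
rewrite normrZ gtr0_norm// -[leRHS]mul1r; apply: ler_pM => //; first exact: ltW.
  exact: ltW.
exact: mtM.
Qed.

(** Turns an estimate on the bracket at time [r] into the decay rate required at the earlier time
    [s]: the rate at [r] is at least [1 / (T - r) >= 1 / (T - s)]. *)
Let rate_mono s r (c g : R) : 0 <= s -> s <= r -> r < T -> 0 <= g -> c <= - g ->
  2 / (1 - ou_scale (T - r) ^+ 2) * c <= - (g / (T - s)).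
Proof.
move=> s0 sr rT g0 cg.
have Tr : 0 < T - r by rewrite subr_gt0.
have Ts : 0 < T - s by lra.
have := ou_rate_ge Tr; set a := 2 / _ => ha.
have ha2 : (T - s)^-1 <= a.
  by apply: le_trans ha; rewrite lef_pV2 ?posrE//; lra.
have Ts' : 0 < (T - s)^-1 by rewrite invr_gt0.
nra.
Qed.

Let zero_projection : is_projection [set 0] (fun _ : 'rV[R]_d => 0).
Proof.
move=> x; split => // u ->; rewrite [X in dot _ X]subrr /dot big1// => i _.
by rewrite [X in _ * X]mxE mulr0.
Qed.

Lemma path_bounded :
  exists2 s1, 0 <= s1 < T & exists B, forall t, s1 <= t < T -> `|X t| <= B.
Proof.
have [s0' /andP[s00 s0T] hn] := n0 ltr01.
(* With remaining time at most [1 / 20], the coefficient [k] of [X r] below is at least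
   [19 / 20]. *)
pose s1 := Num.max s0' (T - 1 / 20).
have s01 : s0' <= s1 by rewrite le_max lexx.
have s1T : 0 <= s1 < T.
  by rewrite (le_trans s00 s01)/= gt_max s0T/=; lra.
have /andP[s10 s1_T] := s1T.
have s1b : T - 1 / 20 <= s1 by rewrite le_max lexx orbT.
exists s1 => //.
(* Young's inequality: the error, linear in the norm of [W s], is at most [c] plus a tenth of its
   square. Once [g >= eps], [c] is itself at most [g / 10], and [- 19 / 20 + 1 / 10 + 1 / 10] is
   below [- 7 / 10]. *)
pose c := 5 / 2 * (d%:R * (M + 2)) ^+ 2.
have M0 : 0 <= M by exact: le_trans (mtM s1T).
pose eps := 10 * c + 1.
have c0 : 0 <= c by rewrite mulr_ge0// sqr_ge0.
have eps0 : 0 < eps by rewrite /eps; lra.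
have cW1 : dist_continuous s1 T W.
  move=> s e /andP[s1s sT] e0; have sT' : 0 <= s < T by rewrite (le_trans s10).
  have [h0 h00 H] := cW sT' e0; exists h0 => // r /andP[s1r rT].
  by apply: H; rewrite (le_trans s10).
have incr1 s t v e : s1 <= s -> s <= t -> t < T ->
    (forall r, s <= r <= t -> dot v (ou_drift r) <= e) ->
    dot v (W t - W s) <= e * (t - s).
  by move=> s1s; apply: incrW; exact: le_trans s1s.
have := lyapunov zero_projection cW1 incr1 eps0.
rewrite /sqr_dist_proj => h.
suff hW : forall t, s1 <= t < T -> dot (W t - 0) (W t - 0) <=
    Num.max eps (dot (W s1 - 0) (W s1 - 0) * (T - t) / (T - s1)).
  pose B := Num.max eps (dot (W s1) (W s1)).
  exists (2 + B) => t tT; have /andP[s1t t_T] := tT.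
  have WB : dot (W t) (W t) <= B.
    have := hW t tT; rewrite !subr0 => /le_trans; apply.
    rewrite ge_max; apply/andP; split; first by rewrite le_max lexx.
    rewrite le_max; apply/orP; right.
    rewrite ler_pdivrMr ?subr_gt0// ler_wpM2l ?dot_ge0//; lra.
  have W1 : `|W t| <= 1 + B.
    have := sqr_norm_le_dot (W t); have : 0 <= `|W t| by [].
    nra.
  rewrite -[X t](subrK (n t)) -/(W t); apply: le_trans (ler_normD _ _) _.
  have : `|n t| <= 1 by apply: hn; rewrite (le_trans s01).
  lra.
apply: h => s /andP[s1s sT]; rewrite !subr0 => gs.
have s0 : 0 <= s by exact: le_trans s1s.
have sT' : 0 <= s < T by rewrite s0.
have [h0 [L [h00 H]]] := local_control sT' ltr01.
exists h0, L; split => // r sr rsh rT; have [Wrs DL] := H r sr rsh rT.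
split => //.
have rT' : 0 <= r < T by rewrite (le_trans s0).
rewrite ou_driftE// dotZr; set g := dot _ _ in gs *.
rewrite (_ : 7 / 10 * (g / (T - s)) = 7 / 10 * g / (T - s)); last by rewrite mulrA.
apply: rate_mono => //; first by rewrite mulr_ge0// dot_ge0.
set l := ou_scale (T - r).
have Tr : 0 < T - r by rewrite subr_gt0.
have l0 : 0 < l by exact: ou_scale_gt0.
have l1 : l < 1 by exact: ou_scale_lt1.
have v0 : 0 < 1 - l ^+ 2 by exact: ou_var_gt0.
have v1 : 1 - l ^+ 2 <= 2 * (T - r) by exact: ou_var_le.
set k := 1 - (1 - l ^+ 2) / 2.
have k1 : 19 / 20 <= k <= 1 by rewrite /k; lra.
have /andP[k2 k3] := k1.
pose rho := (W r - W s) + n r.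
have rho2 : `|rho| <= 2.
  apply: le_trans (ler_normD _ _) _.
  have : `|n r| <= 1 by apply: hn; rewrite rT (le_trans s01)// (le_trans s1s).
  lra.
have Xr : X r = W s + rho by rewrite /rho addrA addrCA subrr addr0 /W subrK.
have -> : dot (W s) (l *: mt r - k *: X r) =
    - k * g + dot (W s) (l *: mt r - k *: rho).
  by rewrite Xr scalerDr opprD addrCA dotDr dotNr dotZr mulNr.
have h1 : dot (W s) (l *: mt r - k *: rho) <= d%:R * (M + 2) * `|W s|.
  apply: le_trans (dot_le_norm _ _) _.
  rewrite -mulrA ler_wpM2l// mulrC ler_wpM2r//.
  apply: le_trans (ler_normB _ _) _; rewrite !normrZ.
  rewrite gtr0_norm// (ger0_norm (_ : 0 <= k)); last lra.
  apply: lerD; rewrite -[leRHS]mul1r; apply: ler_pM => //; try lra.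
  exact: mtM.
have h2 := sqr_norm_le_dot (W s).
have h3 : d%:R * (M + 2) * `|W s| <= c + 1 / 10 * `|W s| ^+ 2.
  by rewrite /c; have := sqr_ge0 (5 * (d%:R * (M + 2)) - `|W s|); lra.
rewrite -/g in h2.
have g0 : 0 <= g by exact: dot_ge0.
have gs' : 10 * c + 1 <= g by exact: gs.
nra.
Qed.

(** * Convergence of the path to the convex set *)

Section path_convergence.
Variables (K : set 'rV[R]_d) (pr : 'rV[R]_d -> 'rV[R]_d).
Hypothesis prP : is_projection K pr.
Hypothesis mtP : forall B, exists C, forall s, 0 <= s < T -> `|X s| <= B ->
  let y := (ou_scale (T - s))^-1 *: X s in
  dot (y - pr y) (mt s - y) <= - sqr_dist_proj pr y + C * (T - s).

(** [mtP] speaks of the rescaled point [y] at time [r], the Lyapunov argument of [W s]. Both points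
    and both brackets differ by [O(eta)], and a bounded path makes the resulting error [O(eta)]. *)
Let drift_estimate B : 0 <= B -> exists2 A, 0 <= A & forall s r eta,
  0 <= s -> s <= r -> r < T -> 0 < eta -> A * eta <= 1 ->
  T - r <= eta -> T - r <= 1 / 20 -> `|X r| <= B -> `|W s - X r| <= 2 * eta ->
  dot (W s - pr (W s)) (ou_scale (T - r) *: mt r
      - (1 - (1 - ou_scale (T - r) ^+ 2) / 2) *: X r)
    <= - sqr_dist_proj pr (W s) + A * eta.
Proof.
move=> B0; have [C hC] := mtP B.
have M0 : 0 <= M by apply: le_trans (mtM (s := 0) _); rewrite ?lexx.
have d0 : 0 <= d%:R :> R by [].
(* [A1 * eta] bounds [W s - y], [A2 * eta] the difference between the bracket [c] and [mt r - y],
   [A3] bounds [c], and [A4] the residual [y - pr y]. [E1], [E2], [E3] control the changes of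
   residual, of bracket and of squared distance. *)
pose A1 := 2 + 2 * B.
pose A2 := M + 3 * B.
pose A3 := M + B.
pose A4 := `|pr 0| + (1 + d%:R) * (2 * B).
have A10 : 0 <= A1 by rewrite /A1; lra.
have A20 : 0 <= A2 by rewrite /A2; lra.
have A30 : 0 <= A3 by rewrite /A3; lra.
have A40 : 0 <= A4 by rewrite /A4 addr_ge0// mulr_ge0//; lra.
pose E1 := d%:R * ((1 + d%:R) * A1 * A3).
pose E2 := d%:R * (A4 * A2).
pose E3 := d%:R * ((1 + d%:R) * (1 + d%:R + 2 * A4)) * A1.
have E10 : 0 <= E1 by rewrite /E1 !mulr_ge0//; lra.
have E20 : 0 <= E2 by rewrite /E2 !mulr_ge0//; lra.
have E30 : 0 <= E3 by rewrite /E3 !mulr_ge0//; lra.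
exists (A1 + `|C| + E1 + E2 + E3); first by have := normr_ge0 C; lra.
move=> s r eta s0 sr rT eta0 etaA tau_eta tau20 XB WX.
have rT' : 0 <= r < T by rewrite (le_trans s0).
have Tr : 0 < T - r by rewrite subr_gt0.
have mr := mtM rT'.
have := hC r rT' XB; rewrite /=; set y := _ *: X r.
set l := ou_scale (T - r) in y *.
have l0 : 0 < l by exact: ou_scale_gt0.
have l1 : l < 1 by exact: ou_scale_lt1.
have l2 : 1 - (T - r) <= l by exact: ou_scale_ge.
have lV : l^-1 <= 1 + 2 * (T - r) by apply: ou_scaleV_le; rewrite Tr/=; lra.
have lV1 : 1 <= l^-1 by rewrite invf_ge1 ?ltW.
have v0 : 0 < 1 - l ^+ 2 by exact: ou_var_gt0.
have v1 : 1 - l ^+ 2 <= 2 * (T - r) by exact: ou_var_le.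
set k := 1 - (1 - l ^+ 2) / 2.
have k1 : k <= 1 by rewrite /k; lra.
have k0 : 0 <= k by rewrite /k; lra.
have kk : 1 - k <= T - r by rewrite /k; lra.
move=> hy.
have X0 : 0 <= `|X r| by [].
have m0 : 0 <= `|mt r| by [].
have yX : `|X r - y| <= 2 * eta * B.
  rewrite -[X in X - y]scale1r /y -scalerBl normrZ distrC ger0_norm ?subr_ge0//.
  by apply: ler_pM => //; lra.
have yB : `|y| <= 2 * B.
  by rewrite /y normrZ ger0_norm ?(le_trans _ lV1)//; apply: ler_pM => //; lra.
have Wy : `|W s - y| <= A1 * eta.
  have -> : W s - y = (W s - X r) + (X r - y) by rewrite addrA subrK.
  by apply: le_trans (ler_normD _ _) _; rewrite /A1; lra.
have Wy1 : `|W s - y| <= 1.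
  apply: le_trans Wy _; apply: le_trans etaA.
  by rewrite ler_wpM2r ?(ltW eta0)//; have := normr_ge0 C; lra.
set c := l *: mt r - k *: X r.
set v := W s - pr (W s).
set v' := y - pr y in hy.
have vv : `|v - v'| <= (1 + d%:R) * A1 * eta.
  apply: le_trans (proj_residual_lipschitz _ _ prP) _.
  by rewrite -[leRHS]mulrA ler_wpM2l// addr_ge0.
have v'4 : `|v'| <= A4.
  rewrite -[v'](subrK (0 - pr 0)) addrC; apply: le_trans (ler_normD _ _) _.
  rewrite sub0r normrN; apply: lerD => //.
  rewrite -[- pr 0]sub0r.
  apply: le_trans (proj_residual_lipschitz _ _ prP) _.
  by rewrite subr0 ler_wpM2l// addr_ge0.
have cc : `|c - (mt r - y)| <= A2 * eta.
  have -> : c - (mt r - y) = (l - 1) *: mt r + (l^-1 - k) *: X r.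
    by apply/rowP => i; rewrite !mxE; ring.
  apply: le_trans (ler_normD _ _) _; rewrite !normrZ distrC.
  rewrite (gtr0_norm (_ : 0 < 1 - l)) ?subr_gt0//.
  rewrite (ger0_norm (_ : 0 <= l^-1 - k)); last lra.
  have : (1 - l) * `|mt r| <= eta * M by apply: ler_pM => //; lra.
  have : (l^-1 - k) * `|X r| <= (3 * eta) * B by apply: ler_pM => //; lra.
  have -> : A2 * eta = eta * M + 3 * eta * B by rewrite /A2; ring.
  by move=> hX hm; exact: lerD.
have c3 : `|c| <= A3.
  apply: le_trans (ler_normB _ _) _; rewrite !normrZ !ger0_norm//; last exact: ltW.
  by apply: lerD; rewrite -[leRHS]mul1r; apply: ler_pM => //; lra.
have h1 : dot (v - v') c <= E1 * eta.
  apply: le_trans (dot_le_norm _ _) _; rewrite /E1 -mulrA ler_wpM2l//.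
  by rewrite mulrAC; apply: ler_pM.
have h2 : dot v' (c - (mt r - y)) <= E2 * eta.
  apply: le_trans (dot_le_norm _ _) _; rewrite /E2 -mulrA ler_wpM2l//.
  by rewrite -mulrA; apply: ler_pM.
have h3 : sqr_dist_proj pr (W s) - sqr_dist_proj pr y <= E3 * eta.
  apply: le_trans (ler_norm _) _.
  apply: le_trans (sqr_dist_proj_sub_le prP Wy1) _.
  rewrite /E3 -[in leRHS]mulrA; apply: ler_pM => //.
  by rewrite !ler_wpM2l ?addr_ge0// lerD2l ler_wpM2l.
have h4 : C * (T - r) <= `|C| * eta.
  apply: le_trans (ler_norm _) _; rewrite normrM (gtr0_norm Tr).
  exact: ler_wpM2l.
have -> : dot v c = dot v' (mt r - y) + dot (v - v') c + dot v' (c - (mt r - y)).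
  by rewrite (dotBl v v' c) (dotBr c (mt r - y) v'); ring.
have : 0 <= A1 * eta by rewrite mulr_ge0// ltW.
lra.
Qed.

Lemma path_sqr_dist_cvg0 e : 0 < e -> exists2 s2, 0 <= s2 < T &
  forall t, s2 <= t < T -> sqr_dist_proj pr (X t) <= e.
Proof.
move=> e0.
have [s1 /andP[s10 s1T] [B0 hB0]] := path_bounded.
pose B := Num.max 0 B0.
have B_ge0 : 0 <= B by rewrite le_max lexx.
have hB t : s1 <= t < T -> `|X t| <= B.
  by move=> /hB0 /le_trans; apply; rewrite le_max lexx orbT.
have [A A0 hA] := drift_estimate B_ge0.
pose V0 := `|pr 0| + (1 + d%:R) * (1 + B).
have V00 : 0 <= V0 by rewrite addr_ge0// mulr_ge0// ?addr_ge0//; lra.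
pose CB := d%:R * ((1 + d%:R) * (1 + d%:R + 2 * V0)).
have CB0 : 0 <= CB by rewrite /CB !mulr_ge0//; have := ler0n R d; lra.
(* The second and third terms give [A * eta <= 1], for [drift_estimate], and [A * eta <= e / 20], a
   tenth of any [g >= e / 2], so that [- g + A * eta <= - 7 / 10 * g]. The last one pays for
   returning from [W] to [X]. *)
pose eta := Num.min (1 / 20) (Num.min ((1 + A)^-1)
  (Num.min (e / (20 * (1 + A))) (e / (2 * (1 + CB))))).
have A1 : 0 < 1 + A by lra.
have CB1 : 0 < 1 + CB by lra.
have eta0 : 0 < eta.
  by rewrite /eta !lt_min invr_gt0 A1 !divr_gt0// mulr_gt0.
have : eta <= eta by [].
rewrite {2}/eta !le_min => /and4P[eta1 eta2 eta3 eta4].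
have {}eta2 : A * eta <= 1.
  by move: eta2; rewrite -[_^-1]mul1r ler_pdivlMr//; lra.
have {}eta3 : A * eta <= e / 20.
  by move: eta3; rewrite ler_pdivlMr ?mulr_gt0//; lra.
have {}eta4 : CB * eta <= e / 2.
  by move: eta4; rewrite ler_pdivlMr ?mulr_gt0//; lra.
have [s0' /andP[s0'0 s0'T] hn] := n0 eta0.
pose s2 := Num.max (Num.max s1 s0') (T - eta).
have s12 : s1 <= s2 by rewrite !le_max lexx.
have s02 : s0' <= s2 by rewrite !le_max lexx orbT.
have seta : T - eta <= s2 by rewrite !le_max lexx orbT.
have s2T : s2 < T by rewrite !gt_max s1T s0'T/=; lra.
have s20 : 0 <= s2 by exact: le_trans s12.
have cW1 : dist_continuous s2 T W.
  move=> s e' /andP[s2s sT] e'0; have sT' : 0 <= s < T by rewrite (le_trans s20).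
  have [h0 h00 H] := cW sT' e'0; exists h0 => // r /andP[s2r rT].
  by apply: H; rewrite (le_trans s20).
have incr1 s t v c : s2 <= s -> s <= t -> t < T ->
    (forall r, s <= r <= t -> dot v (ou_drift r) <= c) ->
    dot v (W t - W s) <= c * (t - s).
  by move=> s1s; apply: incrW; exact: le_trans s1s.
have e2 : 0 < e / 2 by rewrite divr_gt0.
have hn2 t : s2 <= t < T -> `|n t| <= eta.
  by move=> /andP[s2t tT]; apply: hn; rewrite tT (le_trans s02).
have hX2 t : s2 <= t < T -> `|X t| <= B.
  by move=> /andP[s2t tT]; apply: hB; rewrite tT (le_trans s12).
have {cW1 incr1}hW : forall t, s2 <= t < T -> sqr_dist_proj pr (W t) <=
    Num.max (e / 2) (sqr_dist_proj pr (W s2) * (T - t) / (T - s2)).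
  apply: (lyapunov prP cW1 incr1 e2) => s /andP[s2s sT] gs.
  have s0 : 0 <= s by exact: le_trans s2s.
  have sT' : 0 <= s < T by rewrite s0.
  have [h0 [L [h00 H]]] := local_control sT' eta0.
  exists h0, L; split => // r sr rsh rT; have [Wrs DL] := H r sr rsh rT.
  split => //.
  have rT' : 0 <= r < T by rewrite (le_trans s0).
  have rT2 : s2 <= r < T by rewrite rT (le_trans s2s).
  rewrite ou_driftE// dotZr.
  rewrite (_ : 7 / 10 * _ = 7 / 10 * sqr_dist_proj pr (W s) / (T - s)); last first.
    by rewrite mulrA.
  apply: rate_mono => //; first by rewrite mulr_ge0// dot_ge0.
  apply: le_trans (hA s r eta s0 sr rT eta0 eta2 _ _ (hX2 _ rT2) _) _; try lra.
  have -> : W s - X r = - ((W r - W s) + n r).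
    by rewrite /W; apply/rowP => i; rewrite !mxE; ring.
  rewrite normrN; apply: le_trans (ler_normD _ _) _.
  by have := hn2 _ rT2; lra.
pose g2 := sqr_dist_proj pr (W s2).
have g20 : 0 <= g2 by exact: dot_ge0.
have Ts2 : 0 < T - s2 by lra.
(* From [s3] on, the linear part of the barrier is below [e / 2]; [1 + g2] stands for [g2] to allow
   [g2 = 0]. *)
pose s3 := Num.max s2 (T - e / 2 * (T - s2) / (1 + g2)).
have s23 : s2 <= s3 by rewrite le_max lexx.
exists s3.
  rewrite (le_trans s20)//= gt_max s2T/= ltrBlDr ltrDl.
  by rewrite divr_gt0// ?mulr_gt0//; lra.
move=> t /andP[s3t tT].
have tT2 : s2 <= t < T by rewrite tT (le_trans s23).
have Wt : sqr_dist_proj pr (W t) <= e / 2.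
  apply: le_trans (hW t tT2) _; rewrite ge_max lexx/=.
  have : T - e / 2 * (T - s2) / (1 + g2) <= t.
    by apply: le_trans s3t; rewrite le_max lexx orbT.
  rewrite lerBlDr -lerBlDl ler_pdivlMr; last lra.
  by rewrite ler_pdivrMr// -/g2; nra.
have XW : `|X t - W t| <= eta.
  by rewrite /W opprB addrCA subrr addr0; exact: hn2.
have XW1 : `|X t - W t| <= 1 by lra.
have Wpr : `|W t - pr (W t)| <= V0.
  rewrite -[W t - _](subrK (0 - pr 0)) addrC; apply: le_trans (ler_normD _ _) _.
  rewrite sub0r normrN; apply: lerD => //; rewrite -[- pr 0]sub0r.
  apply: le_trans (proj_residual_lipschitz _ _ prP) _.
  rewrite subr0 ler_wpM2l ?addr_ge0//.
  rewrite -[W t](subrK (X t)); apply: le_trans (ler_normD _ _) _.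
  by apply: lerD; rewrite 1?distrC// hX2.
have : sqr_dist_proj pr (X t) - sqr_dist_proj pr (W t) <= CB * eta.
  apply: le_trans (ler_norm _) _.
  apply: le_trans (sqr_dist_proj_sub_le prP XW1) _.
  apply: ler_pM => //; rewrite !ler_wpM2l ?addr_ge0//.
  by rewrite lerD2l ler_wpM2l.
lra.
Qed.

End path_convergence.
End path.

(** * Gaussian smoothing and its score *)

Section smoothing.
Context {R : realType} {d : nat}.
Local Notation mu := (lebesgue_rV R d).
Implicit Types (p f : 'rV[R]_d -> R) (x z u : 'rV[R]_d) (t M : R).

Lemma gauss_kernelE t z : 0 < t -> gauss_kernel t z =
  (Num.sqrt (2 * pi) * ou_std t) ^- d *
  expR (- (dot z z / (2 * (1 - ou_scale t ^+ 2)))).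
Proof.
move=> t0; rewrite /gauss_kernel enorm_sqr /ou_std sqr_sqrtr// ltW//.
exact: ou_var_gt0.
Qed.

Lemma gauss_const_gt0 t : 0 < t -> 0 < (Num.sqrt (2 * pi) * ou_std t : R) ^- d.
Proof.
move=> t0; rewrite invr_gt0 exprn_gt0// mulr_gt0// sqrtr_gt0.
  by rewrite mulr_gt0// pi_gt0.
exact: ou_var_gt0.
Qed.

Lemma gauss_kernel_gt0 t z : 0 < t -> 0 < gauss_kernel t z.
Proof. by move=> t0; rewrite gauss_kernelE// mulr_gt0 ?expR_gt0// gauss_const_gt0. Qed.

Lemma gauss_kernel_le t z : 0 < t ->
  gauss_kernel t z <= (Num.sqrt (2 * pi) * ou_std t) ^- d.
Proof.
move=> t0; rewrite gauss_kernelE// ler_piMr ?(ltW (gauss_const_gt0 t0))//.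
by rewrite expR_le1 oppr_le0 divr_ge0 ?dot_ge0// mulr_ge0// ltW// ou_var_gt0.
Qed.

Lemma measurable_dot_affine (a : R) x :
  measurable_fun setT (fun u : 'rV[R]_d => dot (x - a *: u) (x - a *: u)).
Proof.
apply: measurable_sum => i.
have m1 : measurable_fun setT (fun u : 'rV[R]_d => (x - a *: u) ord0 i).
  under eq_fun do rewrite !mxE.
  apply: measurable_funB => //; apply: measurable_funM => //.
  exact: measurable_rV_coord.
exact: measurable_funM.
Qed.

Lemma measurable_gauss t x : 0 < t ->
  measurable_fun setT (fun u => gauss_kernel t (x - ou_scale t *: u)).
Proof.
move=> t0; under eq_fun do rewrite gauss_kernelE//.
apply: measurable_funM => //; apply: measurableT_comp => //.
apply: measurableT_comp => //; apply: measurable_funM => //.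
exact: measurable_dot_affine.
Qed.

Lemma integrable_density_mul p f C : is_density p ->
  measurable_fun setT f -> (forall u, p u != 0 -> `|f u| <= C) ->
  mu.-integrable setT (EFin \o (fun u => p u * f u)).
Proof.
move=> [mp p0 p1] mf fC.
have ip : mu.-integrable setT (EFin \o p).
  apply/integrableP; split; first exact/measurable_EFinP.
  under eq_integral do rewrite /= ger0_norm//.
  by rewrite p1 ltry.
apply: (le_integrable measurableT _ _ (integrableZl measurableT C ip)).
  by apply/measurable_EFinP; exact: measurable_funM.
move=> u _ /=; rewrite lee_fin !normrM mulrC.
have [->|pu] := eqVneq (p u) 0; first by rewrite normr0 !mulr0.
by rewrite ler_wpM2r//; apply: le_trans (ler_norm _); exact: fC.
Qed.

Lemma integrable_smoothed p t f x C : 0 < t -> is_density p ->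
  measurable_fun setT f -> (forall u, p u != 0 -> `|f u| <= C) ->
  mu.-integrable setT
    (EFin \o (fun u => p u * (gauss_kernel t (x - ou_scale t *: u) * f u))).
Proof.
move=> t0 dp mf fC.
apply: (@integrable_density_mul p _ ((Num.sqrt (2 * pi) * ou_std t) ^- d * C)) => //.
  by apply: measurable_funM => //; exact: measurable_gauss.
move=> u pu; rewrite normrM ler_pM// ?fC//.
by rewrite gtr0_norm ?gauss_kernel_gt0// gauss_kernel_le.
Qed.

(** Unnormalised posterior expectation of [f] at the clean point, given the noisy point [x];
    [smoothed] is its normalising constant. *)
Definition moment p t f x : R :=
  \int[mu]_u (p u * (gauss_kernel t (x - ou_scale t *: u) * f u)).

Definition smoothed p t x : R :=
  \int[mu]_u (p u * gauss_kernel t (x - ou_scale t *: u)).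

Lemma gauss_line_derive t z i (h : R) : 0 < t ->
  is_derive h 1 (fun s : R => gauss_kernel t (s *: delta_mx ord0 i + z))
    (gauss_kernel t (h *: delta_mx ord0 i + z) *
       (- ((z ord0 i + h) / (1 - ou_scale t ^+ 2)))).
Proof.
move=> t0; set v := 1 - _ ^+ 2; set c := (Num.sqrt (2 * pi) * ou_std t) ^- d.
pose q (s : R) : R := - ((dot z z + (2 * z ord0 i) * s + s ^+ 2) / (2 * v)).
have gE s : gauss_kernel t (s *: delta_mx ord0 i + z) = c * expR (q s).
  rewrite gauss_kernelE// -/c -/v /q dot_sqrD !dotZl dotZr !delta_dot.
  rewrite [in X in s * (s * X)]mxE !eqxx mulr1 expr2.
  by rewrite (_ : _ + dot z z = dot z z + 2 * z ord0 i * s + s * s)//; ring.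
have -> : (fun s : R => gauss_kernel t (s *: delta_mx ord0 i + z)) =
    (fun s => c * expR (q s)).
  by apply/funext => s; exact: gE.
rewrite gE.
have v0 : v != 0 by rewrite gt_eqF// ou_var_gt0.
have dq : is_derive h 1 q (- ((z ord0 i + h) / v)).
  rewrite /q; apply: is_derive_eq; rewrite /GRing.scale/=.
  by field.
apply: is_derive_eq; rewrite /GRing.scale/=; ring.
Qed.

Lemma coord_bound u i M : `|u| <= M -> `|u ord0 i| <= M.
Proof. exact: le_trans (coord_le_norm _ _). Qed.

Lemma cvg_is_derive1 (F : R -> R) (a l : R) :
  h^-1 *: (F (h + a) - F a) @[h --> 0^'] --> l -> is_derive a 1 F l.
Proof.
have -> : (fun h : R => h^-1 *: (F (h + a) - F a)) =
    (fun h => h^-1 *: ((F \o shift a) (h *: 1) - F a)).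
  by apply/funext => h; rewrite /= scaler1.
by move=> cF; apply: DeriveDef; [apply/cvg_ex; exists l|exact: cvg_lim].
Qed.

Section density.
Variables (p : 'rV[R]_d -> R) (t M : R).
Hypothesis t0 : 0 < t.
Hypothesis dp : is_density p.
Hypothesis pM : forall u, p u != 0 -> `|u| <= M.

Lemma integrable_smoothed1 x : mu.-integrable setT
  (EFin \o (fun u => p u * gauss_kernel t (x - ou_scale t *: u))).
Proof.
have := @integrable_smoothed p t (cst 1) x 1 t0 dp (@measurable_cst _ _ _ _ _ _).
have -> : (fun u => p u * (gauss_kernel t (x - ou_scale t *: u) * cst 1 u)) =
    (fun u => p u * gauss_kernel t (x - ou_scale t *: u)).
  by apply/funext => u; rewrite mulr1.
by apply=> u _; rewrite normr1.
Qed.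

Lemma integrable_smoothed_coord x i : mu.-integrable setT
  (EFin \o (fun u => p u * (gauss_kernel t (x - ou_scale t *: u) * u ord0 i))).
Proof.
apply: (@integrable_smoothed p t (fun u => u ord0 i) x M t0 dp).
  exact: measurable_rV_coord.
by move=> u /pM; exact: coord_bound.
Qed.

(** Differentiation under the integral along a coordinate line. For [h] in []-1, 1[] the derivative
    is dominated by a constant multiple of [p], because [p] vanishes outside a bounded set. *)
Lemma smoothed_line_derive x i : is_derive (0 : R) 1
  (fun h : R => smoothed p t (h *: delta_mx ord0 i + x))
  ((ou_scale t * moment p t (fun u => u ord0 i) x - x ord0 i * smoothed p t x)
    / (1 - ou_scale t ^+ 2)).
Proof.
set v := 1 - ou_scale t ^+ 2.
have v0 : 0 < v by exact: ou_var_gt0.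
pose f (h : R) u := p u * gauss_kernel t (h *: delta_mx ord0 i + x - ou_scale t *: u).
pose df (h : R) u := p u * (gauss_kernel t (h *: delta_mx ord0 i + (x - ou_scale t *: u)) *
   (- (((x - ou_scale t *: u) ord0 i + h) / v))).
have fd (h : R) u : is_derive h 1 (f ^~ u) (df h u).
  rewrite (_ : f ^~ u = fun s => p u *
      gauss_kernel t (s *: delta_mx ord0 i + (x - ou_scale t *: u))); last first.
    by apply/funext => s; rewrite /f addrA.
  have := gauss_line_derive (x - ou_scale t *: u) i h t0.
  move=> /(is_deriveZ (p u)); exact.
pose c := (Num.sqrt (2 * pi) * ou_std t : R) ^- d.
have c0 : 0 < c by exact: gauss_const_gt0.
have M0 u : p u != 0 -> 0 <= M by move=> /pM; apply: le_trans.
pose C := c * ((`|x| + ou_scale t * M + 1) / v).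
pose G u := p u * `|C|.
have l0 : 0 < ou_scale t by exact: ou_scale_gt0.
have [_ p0 _] := dp.
have part (h : R) u : partial1of2 f h u = df h u.
  by rewrite partial1of2E; exact: (@derive_val _ _ _ _ _ _ _ (fd h u)).
have G_ub (h : R) u : `]-1, 1[%classic h -> setT u -> `|partial1of2 f h u| <= G u.
  rewrite part /= in_itv/= => /andP[h1 h2] _.
  rewrite /df /G normrM ger0_norm//.
  have [->|pu] := eqVneq (p u) 0; first by rewrite !mul0r.
  rewrite ler_wpM2l//; apply: le_trans (ler_norm _).
  rewrite normrM /C ler_pM//.
    by rewrite gtr0_norm ?gauss_kernel_gt0// gauss_kernel_le.
  rewrite normrN normrM (gtr0_norm (_ : 0 < v^-1)) ?invr_gt0// ler_pM2r ?invr_gt0//.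
  apply: le_trans (ler_normD _ _) _; apply: lerD; last by rewrite ler_norml; lra.
  rewrite !mxE; apply: le_trans (ler_normB _ _) _; apply: lerD.
    exact: coord_le_norm.
  by rewrite normrM gtr0_norm// ler_pM2l// coord_bound// pM.
have := @cvg_differentiation_under_integral R _ _ mu f setT measurableT 0 (-1) 1.
move=> /(_ _ _ _ G _ _ G_ub) h.
have {h}hcvg : h^-1 *: ((fun s => \int[mu]_u f s u) (h + 0)
    - (fun s => \int[mu]_u f s u) 0) @[h --> 0^'] -->
    \int[mu]_u partial1of2 f 0 u.
  apply: h.
  - by rewrite /= in_itv/= ltrN10 ltr01.
  - by move=> h _; exact: integrable_smoothed1.
  - by move=> h u _ _; exact: (@ex_derive _ _ _ _ _ _ _ (fd h u)).
  - by move=> u; rewrite mulr_ge0.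
  - by apply: (@integrable_density_mul p (cst `|C|) `|C|) => // u _; rewrite normr_id.
have dE : \int[mu]_u partial1of2 f 0 u =
    (ou_scale t * moment p t (fun u => u ord0 i) x - x ord0 i * smoothed p t x) / v.
  rewrite /moment /smoothed.
  rewrite -RintegralZl//; last exact: integrable_smoothed_coord.
  rewrite -RintegralZl//; last exact: integrable_smoothed1.
  rewrite -RintegralB//; last 2 first.
  - exact: (integrableZl measurableT (ou_scale t) (integrable_smoothed_coord x i)).
  - exact: (integrableZl measurableT (x ord0 i) (integrable_smoothed1 x)).
  rewrite -RintegralZr//; last first.
    exact: (integrableB measurableT
      (integrableZl measurableT (ou_scale t) (integrable_smoothed_coord x i))
      (integrableZl measurableT (x ord0 i) (integrable_smoothed1 x))).
  apply: eq_Rintegral => u _; rewrite part /df scale0r add0r addr0 !mxE.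
  by ring.
by rewrite -dE; exact: cvg_is_derive1 hcvg.
Qed.

(** On the support of [p] the kernel is at least the constant [m], and [p] has mass 1. A negative
    [M] would force [p = 0]. *)
Lemma smoothed_gt0 x : 0 < smoothed p t x.
Proof.
have [mp p0 p1] := dp.
have M0 : 0 <= M.
  apply: contrapT => /negP; rewrite -ltNge => M0.
  have pz : p = cst 0.
    apply/funext => u; apply: contrapT => /eqP /pM.
    by apply/negP; rewrite -ltNge (lt_le_trans M0).
  move: p1; rewrite pz; under eq_integral do rewrite /cst.
  by rewrite integral0 => /eqP; rewrite eq_sym onee_eq0.
pose c := (Num.sqrt (2 * pi) * ou_std t : R) ^- d.
have c0 : 0 < c by exact: gauss_const_gt0.
have v0 : 0 < 1 - ou_scale t ^+ 2 by exact: ou_var_gt0.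
have l0 : 0 < ou_scale t by exact: ou_scale_gt0.
pose m := c * expR (- (d%:R * (`|x| + ou_scale t * M) ^+ 2 / (2 * (1 - ou_scale t ^+ 2)))).
have m0 : 0 < m by rewrite mulr_gt0// expR_gt0.
apply: (lt_le_trans m0).
have -> : m = \int[mu]_u (p u * m).
  rewrite RintegralZr//; last first.
    apply/integrableP; split; first exact/measurable_EFinP.
    under eq_integral do rewrite /= ger0_norm//.
    by rewrite p1 ltry.
  by rewrite /Rintegral p1/= mul1r.
apply: le_Rintegral => //.
- by apply: (@integrable_density_mul p (cst m) `|m|).
- exact: integrable_smoothed1.
move=> u _; have [->|pu] := eqVneq (p u) 0; first by rewrite !mul0r.
rewrite ler_wpM2l// gauss_kernelE// ler_pM2l// ler_expR lerN2.
rewrite ler_pM2r ?invr_gt0 ?mulr_gt0//.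
apply: le_trans (dot_le_norm _ _) _; rewrite ler_wpM2l// -expr2.
rewrite ler_pXn2r ?nnegrE// ?addr_ge0// ?mulr_ge0// ?(ltW l0)//.
apply: le_trans (ler_normB _ _) _; rewrite lerD2l normrZ gtr0_norm//.
by rewrite ler_pM2l// pM.
Qed.

End density.

Definition post_mean p t x : 'rV[R]_d :=
  \row_i (moment p t (fun u => u ord0 i) x / smoothed p t x).

Lemma derive_line (f : 'rV[R]_d -> R) x v :
  'D_v f x = 'D_1 (fun h : R => f (h *: v + x)) 0.
Proof.
rewrite /derive.
have -> // : (fun h : R => h^-1 *: ((f \o shift x) (h *: v) - f x)) =
  (fun h => h^-1 *: (((fun k : R => f (k *: v + x)) \o shift 0) (h *: 1)
    - f (0 *: v + x))).
by apply/funext => h /=; rewrite addr0 scale0r add0r scaler1.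
Qed.

(** Tweedie's formula, one coordinate at a time. *)
Lemma ln_smoothed_line_derive p t M x i : 0 < t -> is_density p ->
  (forall u, p u != 0 -> `|u| <= M) ->
  is_derive (0 : R) 1 (fun h : R => ln (smoothed p t (h *: delta_mx ord0 i + x)))
    ((ou_scale t * post_mean p t x ord0 i - x ord0 i) / (1 - ou_scale t ^+ 2)).
Proof.
move=> t0 dp pM.
have s0 := smoothed_gt0 t0 dp pM.
have ds := smoothed_line_derive t0 dp pM x i.
have v0 : 1 - ou_scale t ^+ 2 != 0 by rewrite gt_eqF// ou_var_gt0.
have sx : smoothed p t x != 0 by rewrite gt_eqF.
have := is_derive1_comp (is_derive1_ln (s0 (0 *: delta_mx ord0 i + x))) ds.
rewrite scale0r add0r mxE.
set a := (X in is_derive _ _ _ X -> _); set b := (X in _ -> is_derive _ _ _ X).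
by have -> : a = b by rewrite /a /b; field; rewrite v0.
Qed.

(** * The mixture as one density, and the guided drift in terms of posterior means *)

Section mixture.
Variables (I : finType) (w : I -> R) (p : I -> 'rV[R]_d -> R) (M : R).
Hypothesis w0 : forall eta, 0 <= w eta.
Hypothesis w1 : \sum_eta w eta = 1.
Hypothesis dp : forall eta, is_density (p eta).
Hypothesis pM : forall eta u, p eta u != 0 -> `|u| <= M.

Definition mixture u : R := \sum_eta w eta * p eta u.

Lemma mixture_density : is_density mixture.
Proof.
split.
- apply: measurable_sum => eta; apply: measurable_funM => //.
  by have [] := dp eta.
- move=> u; apply: sumr_ge0 => eta _; rewrite mulr_ge0//.
  by have [_ + _] := dp eta.
under eq_integral do rewrite /mixture -sumEFin.
rewrite ge0_integral_sum//.
- under eq_bigr => eta _.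
    have [mp p0 p1] := dp eta.
    have -> : (\int[mu]_u (w eta * p eta u)%:E = (w eta)%:E)%E.
      under eq_integral do rewrite EFinM.
      rewrite (ge0_integralZl_EFin _ measurableT) ?p1 ?mule1//.
        by move=> u _; rewrite lee_fin.
      exact/measurable_EFinP.
    over.
  by rewrite sumEFin w1.
- move=> eta; apply/measurable_EFinP; apply: measurable_funM => //.
  by have [] := dp eta.
- move=> eta u _; rewrite lee_fin mulr_ge0//.
  by have [_ + _] := dp eta.
Qed.

Lemma mixture_support u : mixture u != 0 -> `|u| <= M.
Proof.
move=> mu0; apply: contrapT => uM; move/eqP : mu0; apply.
apply: big1 => eta _; have [->|/pM//] := eqVneq (p eta u) 0.
by rewrite mulr0.
Qed.

(** Smoothing is linear, so Tweedie's formula applies to the mixture as to a single density. *)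
Lemma noised_mixtureE t x : 0 < t -> noised_mixture w p t x = smoothed mixture t x.
Proof.
move=> t0; rewrite /noised_mixture.
have int eta : mu.-integrable setT (fun u =>
    (w eta * (p eta u * gauss_kernel t (x - ou_scale t *: u)))%:E).
  exact: (integrableZl measurableT (w eta) (integrable_smoothed1 t0 (dp eta) x)).
rewrite /smoothed /Rintegral /mixture.
under [in RHS]eq_integral do rewrite mulr_suml -sumEFin.
under [in RHS]eq_integral do under eq_bigr do rewrite -mulrA.
rewrite (integral_sum measurableT int).
rewrite -sum_fine => [|eta _]; last exact: integrable_fin_num.
apply: eq_bigr => eta _; rewrite /noised_component.
by rewrite -RintegralZl//; exact: (integrable_smoothed1 t0 (dp eta) x).
Qed.

(** The log posterior is a constant plus the difference of two log densities, so the terms in [x]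
    cancel in its gradient. Adding the mixture score leaves the weights [gamma] and [1 - gamma] on
    the two means. *)
Lemma guided_driftE (T gamma : R) eta0 s x : s < T -> 0 < w eta0 ->
  guided_drift w p T gamma eta0 s x =
  x + (2 / (1 - ou_scale (T - s) ^+ 2)) *: (ou_scale (T - s) *:
    (gamma *: post_mean (p eta0) (T - s) x + (1 - gamma) *: post_mean mixture (T - s) x)
    - x).
Proof.
move=> sT weta0; have t0 : 0 < T - s by rewrite subr_gt0.
apply/rowP => i.
have dmix := ln_smoothed_line_derive x i t0 mixture_density mixture_support.
have d0 := ln_smoothed_line_derive x i t0 (dp eta0) (@pM eta0).
have smix y := smoothed_gt0 t0 mixture_density mixture_support y.
have s0 y := smoothed_gt0 t0 (dp eta0) (@pM eta0) y.
rewrite /guided_drift !mxE !derive_line.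
under eq_fun do rewrite noised_mixtureE//.
rewrite (@derive_val _ _ _ _ _ _ _ dmix).
have -> : (fun h : R => ln (posterior w p (T - s) eta0 (h *: delta_mx ord0 i + x))) =
    (fun h => ln (w eta0) + ln (smoothed (p eta0) (T - s) (h *: delta_mx ord0 i + x))
       - ln (smoothed mixture (T - s) (h *: delta_mx ord0 i + x))).
  apply/funext => h; rewrite /posterior noised_mixtureE//.
  have -> : noised_component p (T - s) eta0 (h *: delta_mx ord0 i + x) =
    smoothed (p eta0) (T - s) (h *: delta_mx ord0 i + x) by [].
  by rewrite ln_div ?lnM ?posrE ?mulr_gt0.
have dpost := is_deriveB (is_deriveD (is_derive_cst (ln (w eta0)) (0 : R) 1) d0) dmix.
rewrite (@derive_val _ _ _ _ _ _ _ dpost) !mxE.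
have v0 : 1 - ou_scale (T - s) ^+ 2 != 0 by rewrite gt_eqF// ou_var_gt0.
by rewrite add0r; field; rewrite v0 !gt_eqF.
Qed.

End mixture.

End smoothing.

(** * Posterior means near the end of the diffusion *)

Section volume.
Context {R : realType} {d : nat}.
Local Notation mu := (lebesgue_rV R d).
Implicit Types (K : set 'rV[R]_d) (z u c : 'rV[R]_d).

Definition box c (r : R) : set 'rV[R]_d :=
  [set u | forall i, `[c ord0 i - r, c ord0 i + r]%classic (u ord0 i)].

Lemma boxP c r u : 0 <= r -> box c r u <-> `|u - c| <= r.
Proof.
move=> r0; split => h.
  apply: norm_le_coord => // i; rewrite !mxE ler_distl.
  by have := h i; rewrite /= in_itv.
move=> i /=; rewrite in_itv/= -ler_distl.
by apply: le_trans h; have := coord_le_norm (u - c) i; rewrite !mxE.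
Qed.

Lemma measurable_box c r : measurable (box c r).
Proof.
rewrite (_ : box c r = \bigcap_(i in [set: 'I_d])
    (@rV_coord _ R d i @^-1` `[c ord0 i - r, c ord0 i + r]%classic)).
  apply: fin_bigcap_measurable => // i _.
  by rewrite -[X in measurable X]setTI; exact: measurable_rV_coord.
by apply/seteqP; split=> u /= h i; [move=> _|]; exact: h.
Qed.

Lemma box_volume c r : 0 <= r -> mu (box c r) = ((r *+ 2) ^+ d)%:E.
Proof.
move=> r0; rewrite (@lebesgue_rV_box R d (fun i => `[c ord0 i - r, c ord0 i + r]%classic))//.
under eq_bigr => i _.
  rewrite lebesgue_measure_itv/= lte_fin.
  have -> : (if c ord0 i - r < c ord0 i + r
      then ((c ord0 i + r)%:E - (c ord0 i - r)%:E)%E else 0%E) = (r *+ 2)%:E.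
    case: ltP => [_|]; first by rewrite -EFinB; congr EFin; ring.
    move=> h; congr EFin; lra.
  over.
by rewrite prodEFin prodr_const card_ord.
Qed.

(* Contracting an interior ball of a convex set towards [z] keeps it inside the
   set, so the volume near [z] is bounded below uniformly in [z]. *)
Lemma uniform_volume K N r : convex_set K -> (forall u, K u -> `|u| <= N) ->
  K° !=set0 -> 0 < r ->
  exists2 v, 0 < v & forall z, K z -> exists A, [/\ measurable A,
    mu A = v%:E, A `<=` K & forall u, A u -> `|u - z| <= r].
Proof.
move=> cK KN [c /nbhs_ballP[rho0 /= rho00 cball]] r0.
pose rho := rho0 / 2.
have rho_gt0 : 0 < rho by rewrite divr_gt0.
have hrho u : `|u - c| <= rho -> K u.
  move=> uc; apply: cball; rewrite -ball_normE /ball_/= distrC.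
  by apply: le_lt_trans uc _; rewrite /rho; lra.
have N0 : 0 <= N by apply: le_trans (KN c _) => //; apply: hrho; rewrite subrr normr0 ltW.
pose s := Num.min 1 (r / (1 + 2 * N)).
have N1 : 0 < 1 + 2 * N by lra.
have s0 : 0 < s by rewrite lt_min ltr01 divr_gt0.
have s1 : s <= 1 by rewrite ge_min lexx.
have sr : s * (2 * N) <= r.
  have : s <= r / (1 + 2 * N) by rewrite ge_min lexx orbT.
  by rewrite ler_pdivlMr//; nra.
have srho : 0 < s * rho by exact: mulr_gt0.
exists (((s * rho) *+ 2) ^+ d); first by rewrite exprn_gt0// mulrn_wgt0.
move=> z Kz; pose b := z + s *: (c - z).
pose e u := z + s^-1 *: (u - z).
have ue u : u = z + s *: (e u - z).
  by rewrite /e addrAC subrr add0r scalerA mulfV ?gt_eqF// scale1r addrC subrK.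
have Ke u : `|u - b| <= s * rho -> K (e u).
  move=> ub; apply: hrho.
  have -> : e u - c = s^-1 *: (u - b).
    apply/rowP => i; rewrite /e /b !mxE; field; exact: lt0r_neq0.
  by rewrite normrZ gtr0_norm ?invr_gt0// mulrC ler_pdivrMr// mulrC.
exists (box b (s * rho)); split.
- exact: measurable_box.
- by rewrite box_volume// ltW.
- move=> u /(boxP _ _ (ltW srho)) ub; rewrite (ue u); apply: convex_setP => //.
    by rewrite ltW.
  exact: Ke.
- move=> u /(boxP _ _ (ltW srho)) ub; rewrite {1}(ue u) addrAC subrr add0r.
  rewrite normrZ gtr0_norm//; apply: le_trans sr; rewrite ler_pM2l//.
  apply: le_trans (ler_normB _ _) _.
  have := KN _ (Ke _ ub); have := KN _ Kz; lra.
Qed.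

End volume.

Section posterior_mean.
Context {R : realType} {d : nat}.
Local Notation mu := (lebesgue_rV R d).
Implicit Types (p f : 'rV[R]_d -> R) (x y z u v c : 'rV[R]_d).

Lemma measurable_dot_shift v c :
  measurable_fun setT (fun u : 'rV[R]_d => dot v (u - c)).
Proof.
apply: measurable_sum => i; apply: measurable_funM => //.
under eq_fun do rewrite !mxE.
by apply: measurable_funB => //; exact: measurable_rV_coord.
Qed.

Section density.
Variables (p : 'rV[R]_d -> R) (t M : R).
Hypothesis t0 : 0 < t.
Hypothesis dp : is_density p.
Hypothesis pM : forall u, p u != 0 -> `|u| <= M.

Let dot_shift_bound v c u : p u != 0 -> `|dot v (u - c)| <= d%:R * (`|v| * (M + `|c|)).
Proof.
move=> /pM uM; apply: le_trans (dot_norm_le _ _) _; rewrite !ler_wpM2l//.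
by apply: le_trans (ler_normB _ _) _; rewrite lerD2r.
Qed.

Lemma integrable_moment_dot x v c : mu.-integrable setT (EFin \o (fun u =>
  p u * (gauss_kernel t (x - ou_scale t *: u) * dot v (u - c)))).
Proof.
exact: (@integrable_smoothed _ _ p t (fun u => dot v (u - c)) x _ t0 dp
  (measurable_dot_shift v c) (dot_shift_bound v c)).
Qed.

Lemma moment_dot x v c : moment p t (fun u => dot v (u - c)) x =
  smoothed p t x * dot v (post_mean p t x - c).
Proof.
have s0 : 0 < smoothed p t x by exact: smoothed_gt0 pM x.
pose f i u := v ord0 i *
  (p u * (gauss_kernel t (x - ou_scale t *: u) * u ord0 i)).
have intf i : mu.-integrable setT (fun u => (f i u)%:E).
  exact: (integrableZl measurableT (v ord0 i) (integrable_smoothed_coord t0 dp pM x i)).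
have intS : mu.-integrable setT (fun u => (\sum_(i < d) f i u)%:E).
  under eq_fun do rewrite -sumEFin.
  exact: integrable_sum.
have int1 := integrable_smoothed1 t0 dp x.
transitivity (\int[mu]_u (\sum_(i < d) f i u -
    dot v c * (p u * gauss_kernel t (x - ou_scale t *: u)))).
  apply: eq_Rintegral => u _; rewrite dotBr.
  have -> : \sum_(i < d) f i u =
      p u * (gauss_kernel t (x - ou_scale t *: u) * dot v u).
    rewrite /dot !mulr_sumr; apply: eq_bigr => i _; rewrite /f; ring.
  by ring.
rewrite RintegralB//; last exact: (integrableZl measurableT (dot v c) int1).
rewrite RintegralZl// -/(smoothed p t x) dotBr mulrBr (mulrC _ (dot v c)).
congr (_ - _); rewrite /dot mulr_sumr /Rintegral.
under eq_integral do rewrite -sumEFin.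
rewrite (integral_sum measurableT intf).
rewrite -sum_fine => [|i _]; last exact: integrable_fin_num.
apply: eq_bigr => i _.
rewrite -/(Rintegral mu setT (f i)) /f RintegralZl//; last first.
  exact: (integrable_smoothed_coord t0 dp pM x i).
by rewrite mxE /moment; field; rewrite gt_eqF.
Qed.

(** A posterior mean is an average over the support, so it lies in every half-space containing that
    support. *)
Lemma post_mean_dot_le x v c a : (forall u, p u != 0 -> dot v (u - c) <= a) ->
  dot v (post_mean p t x - c) <= a.
Proof.
move=> ha; have s0 : 0 < smoothed p t x by exact: smoothed_gt0 pM x.
have int1 := integrable_smoothed1 t0 dp x.
rewrite -(ler_pM2l s0) -moment_dot mulrC /moment.
rewrite -[leRHS]RintegralZl//; apply: le_Rintegral => //.
- exact: integrable_moment_dot.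
- exact: (integrableZl measurableT a int1).
move=> u _; have [->|pu] := eqVneq (p u) 0; first by rewrite !mul0r mulr0.
have [_ p0 _] := dp.
rewrite [leRHS]mulrCA ler_wpM2l// mulrC ler_wpM2r ?(ltW (gauss_kernel_gt0 _ t0))//.
exact: ha.
Qed.

Lemma post_mean_norm x : 0 <= M -> `|post_mean p t x| <= M.
Proof.
move=> M0; apply: norm_le_coord => // i; rewrite ler_norml.
rewrite -delta_dot -[post_mean p t x]subr0 lerNl -dotNl.
apply/andP; split; apply: post_mean_dot_le => u pu;
  rewrite subr0 ?dotNl delta_dot -?normrN; have := coord_bound i (pM pu);
  by rewrite ler_norml lerNl => /andP[].
Qed.

End density.

(** * Guidance does not push the path out of the target set *)

Section key_inequality.
Variables (K : set 'rV[R]_d) (pr : 'rV[R]_d -> 'rV[R]_d) (p0 pm : 'rV[R]_d -> R).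
Variables (w M c0 delta : R).
Hypothesis prP : is_projection K pr.
Hypothesis cK : convex_set K.
Hypothesis KM : forall u, K u -> `|u| <= M.
Hypothesis K0 : K° !=set0.
Hypotheses (d0 : is_density p0) (dm : is_density pm).
Hypothesis p0K : forall u, p0 u != 0 -> K u.
Hypothesis pmM : forall u, pm u != 0 -> `|u| <= M.
Hypotheses (w_gt0 : 0 < w) (c0_gt0 : 0 < c0) (delta_gt0 : 0 < delta).
Hypothesis p0c : forall u, K u -> c0 <= p0 u.
Hypothesis w_le : forall u, w * p0 u <= pm u.
(** The excess of [pm] over [w * p0] is the mass of the other components; it lives at distance at
    least [delta] from [K]. *)
Hypothesis sep : forall u z, pm u != w * p0 u -> K z -> delta <= `|u - z|.

Let p0M u : p0 u != 0 -> `|u| <= M.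
Proof. by move=> /p0K /KM. Qed.

Let theta (t : R) : R := (1 - ou_scale t ^+ 2) / ou_scale t ^+ 2.

Let kernelE t y u : 0 < t ->
  gauss_kernel t (ou_scale t *: y - ou_scale t *: u) =
  (Num.sqrt (2 * pi) * ou_std t) ^- d *
    expR (- ((dot (y - pr y) (y - pr y) - 2 * dot (y - pr y) (u - pr y)
      + dot (u - pr y) (u - pr y)) / (2 * theta t))).
Proof.
move=> t0; rewrite gauss_kernelE// -scalerBr dotZl dotZr.
have -> : y - u = (y - pr y) - (u - pr y) by rewrite opprB addrA subrK.
rewrite dot_sqrB; congr (_ * expR (- _)); rewrite /theta; field.
by rewrite !gt_eqF ?ou_scale_gt0 ?ou_var_gt0.
Qed.

Let theta_gt0 t : 0 < t -> 0 < theta t.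
Proof. by move=> t0; rewrite divr_gt0 ?ou_var_gt0// exprn_gt0// ou_scale_gt0. Qed.

(* Common scale of the two estimates below: the kernel at squared distance
   [|y - pr y|^2 + delta^2]. *)
Let N (t : R) y : R := (Num.sqrt (2 * pi) * ou_std t) ^- d *
  expR (- ((dot (y - pr y) (y - pr y) + delta ^+ 2) / (2 * theta t))).

(** Only a negative product [A] matters. The cross term of the squared distance then contributes a
    factor [expR (A / theta t)], and [s * exp (- s) <= 1] with [s = - A / theta t] bounds that
    factor times [- A] by [theta t]. *)
Let far_estimate t y u : 0 < t -> delta <= `|u - pr y| ->
  - (N t y * theta t) <=
  gauss_kernel t (ou_scale t *: y - ou_scale t *: u) * dot (y - pr y) (u - pr y).
Proof.
move=> t0 du; have th0 := theta_gt0 t0.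
have C0 := @gauss_const_gt0 R d t t0.
have k0 := gauss_kernel_gt0 (ou_scale t *: y - ou_scale t *: u) t0.
have [A0|A0] := leP 0 (dot (y - pr y) (u - pr y)).
  apply: (@le_trans _ _ 0); last by rewrite mulr_ge0// ltW.
  by rewrite oppr_le0 mulr_ge0// ?ltW// mulr_gt0// expR_gt0.
rewrite lerNl -mulrN kernelE//.
set A := dot (y - pr y) (u - pr y) in A0 *.
set g := dot _ _; set b := dot (u - pr y) (u - pr y).
rewrite /N -/g -!mulrA ler_pM2l//.
have bd : delta ^+ 2 <= b.
  apply: le_trans (sqr_norm_le_dot _).
  by rewrite ler_pXn2r ?nnegrE// ltW.
apply: (@le_trans _ _ (expR (- ((g + delta ^+ 2) / (2 * theta t))) *
    (expR (A / theta t) * - A))).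
  rewrite mulrA ler_pM2r ?oppr_gt0// -expRD ler_expR.
  rewrite -subr_ge0.
  have -> : - ((g + delta ^+ 2) / (2 * theta t)) + A / theta t
     - - ((g - 2 * A + b) / (2 * theta t)) = (b - delta ^+ 2) / (2 * theta t).
    by field; rewrite gt_eqF.
  by rewrite divr_ge0// ?subr_ge0// mulr_ge0// ltW.
rewrite ler_pM2l ?expR_gt0//.
have := expR_ge1Dx (- (A / theta t)); rewrite expRN => h.
rewrite mulrC -ler_pdivlMr ?expR_gt0//.
have : - (A / theta t) <= (expR (A / theta t))^-1 by lra.
by rewrite -mulNr ler_pdivrMr// mulrC.
Qed.

Let near_estimate V : 0 <= V -> exists2 v, 0 < v & forall t y, 0 < t ->
  `|y - pr y| <= V -> v * N t y <= smoothed pm t (ou_scale t *: y).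
Proof.
move=> V0; pose r := Num.min 1 (delta ^+ 2 / (1 + d%:R * (2 * V + 1))).
have r1 : 0 < 1 + d%:R * (2 * V + 1) by rewrite ltr_pwDl// mulr_ge0//; lra.
have r0 : 0 < r by rewrite lt_min ltr01 divr_gt0// exprn_gt0.
have rle1 : r <= 1 by rewrite ge_min lexx.
have rd : d%:R * (2 * V + 1) * r <= delta ^+ 2.
  have : r <= delta ^+ 2 / (1 + d%:R * (2 * V + 1)) by rewrite ge_min lexx orbT.
  by rewrite ler_pdivlMr//; lra.
have [vol vol0 hvol] := uniform_volume cK KM K0 r0.
exists (w * c0 * vol); first by rewrite !mulr_gt0.
move=> t y t0 yV; have th0 := theta_gt0 t0.
have [A [mA muA AK Ar]] := hvol _ (prP y).1.
have C0 := @gauss_const_gt0 R d t t0.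
have N0 : 0 < N t y by rewrite mulr_gt0// expR_gt0.
have iA : mu.-integrable setT (fun u => (\1_A u)%:E).
  apply/integrableP; split; first exact/measurable_EFinP.
  under eq_integral do rewrite /= ger0_norm//.
  by rewrite integral_indic// setIT [X in (X < _)%E]muA ltry.
have -> : w * c0 * vol * N t y = \int[mu]_u (w * c0 * N t y * \1_A u).
  rewrite RintegralZl//.
  rewrite /Rintegral integral_indic// setIT [X in fine X]muA/=; ring.
apply: le_Rintegral => //.
- exact: (integrableZl measurableT (w * c0 * N t y) iA).
- exact: integrable_smoothed1.
move=> u _; have pmu : 0 <= pm u by have [_ + _] := dm.
have k0 := gauss_kernel_gt0 (ou_scale t *: y - ou_scale t *: u) t0.
rewrite indicE; case: (boolP (u \in A)) => [/set_mem Au|_]; last first.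
  by rewrite mulr0 mulr_ge0// ltW.
rewrite mulr1; apply: ler_pM; [by rewrite ltW// mulr_gt0|exact: ltW| |].
  apply: le_trans (w_le u); rewrite ler_pM2l//; apply: p0c; exact: AK.
have th2 : 0 < (2 * theta t)^-1 by rewrite invr_gt0 pmulr_rgt0.
rewrite kernelE// /N ler_pM2l// ler_expR lerN2 (ler_pM2r th2).
have ur := Ar _ Au.
have ur0 := normr_ge0 (u - pr y).
have h1 : - (2 * dot (y - pr y) (u - pr y)) <= 2 * (d%:R * (V * r)).
  rewrite -mulrN -dotNl ler_wpM2l//; apply: le_trans (dot_le_norm _ _) _.
  by rewrite normrN ler_wpM2l// ler_pM.
have h2 : dot (u - pr y) (u - pr y) <= d%:R * r.
  apply: le_trans (dot_le_norm _ _) _; rewrite ler_wpM2l//.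
  by rewrite -[leRHS]mul1r ler_pM// (le_trans ur).
lra.
Qed.

(* Compared with [p0], the mixture [pm] has extra mass on the inner side of the
   supporting half-space of [K] at [pr y] only at distance at least [delta] from
   [pr y], where the kernel is too small for the guidance to push out of [K]. *)
Let guidance_estimate V : 0 <= V -> exists2 C, 0 <= C & forall t y, 0 < t ->
  `|y - pr y| <= V ->
  dot (y - pr y) (post_mean p0 t (ou_scale t *: y) - post_mean pm t (ou_scale t *: y))
    <= C * theta t.
Proof.
move=> V0; have [v v0 hv] := near_estimate V0.
exists v^-1; first by rewrite invr_ge0 ltW.
move=> t y t0 yV; have th0 := theta_gt0 t0.
have C0 := @gauss_const_gt0 R d t t0.
have N0 : 0 < N t y by rewrite mulr_gt0// expR_gt0.
have vN := hv t y t0 yV.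
set x := ou_scale t *: y in vN *.
set q := y - pr y.
have -> : post_mean p0 t x - post_mean pm t x =
    (post_mean p0 t x - pr y) - (post_mean pm t x - pr y).
  by rewrite opprB addrA subrK.
rewrite dotBr.
set a0 := dot q _; set am := dot q (post_mean pm t x - pr y).
have a0_le : a0 <= 0.
  apply: (post_mean_dot_le t0 d0 p0M) => u /p0K; exact: (prP y).2.
set c := N t y * theta t.
have c_ge0 : 0 <= c by rewrite mulr_ge0// ltW.
have e0 := smoothed_gt0 t0 d0 p0M x.
have em := smoothed_gt0 t0 dm pmM x.
have int p (dp : is_density p) (pM : forall u, p u != 0 -> `|u| <= M) :
    mu.-integrable setT (EFin \o p) /\
    mu.-integrable setT (EFin \o (fun u => p u * (gauss_kernel t
      (x - ou_scale t *: u) * dot q (u - pr y)))).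
  split; last exact: integrable_moment_dot pM _ _ _.
  have := @integrable_density_mul _ _ p (cst 1) 1 dp.
  have -> : (fun u => p u * cst 1 u) = p by apply/funext => u; rewrite mulr1.
  by apply=> // u _; rewrite normr1.
have intc p (dp : is_density p) (pM : forall u, p u != 0 -> `|u| <= M) :
    mu.-integrable setT (EFin \o (fun u => p u * (gauss_kernel t
      (x - ou_scale t *: u) * dot q (u - pr y)) + p u * c)).
  have [i1 i2] := int p dp pM.
  exact: (integrableD measurableT i2 (integrableZr measurableT c i1)).
have Dc p (dp : is_density p) (pM : forall u, p u != 0 -> `|u| <= M) :
    smoothed p t x * dot q (post_mean p t x - pr y) + c =
    \int[mu]_u (p u * (gauss_kernel t (x - ou_scale t *: u) * dot q (u - pr y))
      + p u * c).
  have [i1 i2] := int p dp pM.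
  rewrite RintegralD//; last exact: (integrableZr measurableT c i1).
  rewrite -/(moment p t (fun u => dot q (u - pr y)) x) (moment_dot t0 dp pM).
  congr (_ + _); rewrite RintegralZr//.
  have [_ _ p1] := dp.
  by rewrite /Rintegral p1/= mul1r.
(* By [far_estimate], adding [c] makes the factor multiplying the density nonnegative wherever [pm]
   differs from [w * p0]. There [w * p0 <= pm] can be used pointwise; elsewhere the integrands
   agree. *)
have main : w * (smoothed p0 t x * a0 + c) <= smoothed pm t x * am + c.
  rewrite !Dc// -RintegralZl//; last exact: intc.
  apply: le_Rintegral => //.
  - exact: (integrableZl measurableT w (intc _ d0 p0M)).
  - exact: intc.
  move=> u _; rewrite -!mulrDr mulrA.
  have [->//|upm] := eqVneq (pm u) (w * p0 u).
  rewrite ler_wpM2r ?w_le// -lerBlDr sub0r.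
  exact: far_estimate t0 (sep upm (prP y).1).
have mass : w * smoothed p0 t x <= smoothed pm t x.
  rewrite -RintegralZl//; last exact: (integrable_smoothed1 t0 d0).
  apply: le_Rintegral => //.
  - exact: (integrableZl measurableT w (integrable_smoothed1 t0 d0 x)).
  - exact: (integrable_smoothed1 t0 dm).
  move=> u _; rewrite mulrA ler_wpM2r ?w_le// ltW//.
  exact: gauss_kernel_gt0.
have wc : 0 <= w * c by rewrite mulr_ge0// ltW.
(* Since [a0 <= 0], [mass] replaces [w * smoothed p0 t x] by the larger [smoothed pm t x] in front
   of [a0]. *)
have h1 : smoothed pm t x * (a0 - am) <= c.
  have := ler_wnM2r a0_le mass; lra.
rewrite -(ler_pM2l em); apply: (le_trans h1).
rewrite mulrA /c ler_pM2r//.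
by rewrite ler_pdivlMr// mulrC.
Qed.

Lemma guided_mean_estimate gamma V T : 1 <= gamma -> 0 <= V -> 0 < T ->
  exists2 C, 0 <= C & forall t y, 0 < t <= T -> `|y - pr y| <= V ->
  dot (y - pr y) ((gamma *: post_mean p0 t (ou_scale t *: y) +
      (1 - gamma) *: post_mean pm t (ou_scale t *: y)) - y)
    <= - sqr_dist_proj pr y + C * t.
Proof.
move=> g1 V0 T0; have [C C0 hC] := guidance_estimate V0.
have lT := @ou_scale_gt0 R T.
exists ((gamma - 1) * (C * (2 / ou_scale T ^+ 2))).
  by rewrite !mulr_ge0 ?subr_ge0 ?invr_ge0 ?exprn_ge0// ltW.
move=> t y /andP[t0 tT] yV; have := hC t y t0 yV.
set m0 := post_mean p0 _ _; set m := post_mean pm _ _ => h.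
have thle : theta t <= 2 / ou_scale T ^+ 2 * t.
  rewrite /theta mulrAC; apply: ler_pM; first exact/ltW/ou_var_gt0.
  - by rewrite invr_ge0 exprn_ge0// ltW// ou_scale_gt0.
  - exact: ou_var_le.
  rewrite lef_pV2 ?posrE ?exprn_gt0 ?ou_scale_gt0//.
  by rewrite ler_pXn2r ?nnegrE ?(ltW (ou_scale_gt0 _))// ler_expR lerN2.
(* Tested against the residual, the first term is nonpositive by convexity, the second is the
   guidance error [O(t)], and the last gives minus the squared distance. *)
have -> : gamma *: m0 + (1 - gamma) *: m - y =
    (m0 - pr y) + (gamma - 1) *: (m0 - m) - (y - pr y).
  by apply/rowP => i; rewrite !mxE; ring.
rewrite dotBr dotDr dotZr.
have : dot (y - pr y) (m0 - pr y) <= 0.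
  apply: (post_mean_dot_le t0 d0 p0M) => u /p0K; exact: (prP y).2.
have : (gamma - 1) * dot (y - pr y) (m0 - m) <=
    (gamma - 1) * (C * (2 / ou_scale T ^+ 2)) * t.
  rewrite -mulrA ler_wpM2l ?subr_ge0//; apply: (le_trans h).
  by rewrite -mulrA ler_wpM2l.
rewrite /sqr_dist_proj; lra.
Qed.

End key_inequality.
End posterior_mean.

(** * From the equation to the path estimate *)

Section assembly.
Context {R : realType} {d : nat}.
Local Notation mu := (@lebesgue_measure R).

Lemma within_continuous_dist (V : normedModType R) (A : set R) (f : R -> V) :
  {within A, continuous f} -> forall s e : R, A s -> 0 < e ->
  exists2 h, 0 < h & forall r, A r -> `|r - s| < h -> `|f r - f s| < e.
Proof.
move=> /subspace_continuousP cf s e As e0.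
have /cvgr_dist_lt/(_ _ e0) := cf s As.
rewrite near_withinE => /nbhs_ballP[h /= h0 hf].
exists h => // r Ar rs; rewrite distrC; apply: hf => //.
by rewrite -ball_normE /ball_/= distrC.
Qed.

Lemma dist_to_projection K pr (x : 'rV[R]_d) : is_projection K pr ->
  0 <= dist_to x K <= Num.sqrt (sqr_dist_proj pr x).
Proof.
move=> prP; apply/andP; split.
  apply: lb_le_inf; first by exists (enorm (x - pr x)), (pr x) => //; exact: (prP x).1.
  by move=> _ [y _ <-]; exact: sqrtr_ge0.
rewrite /sqr_dist_proj -enorm_dot; apply: ge_inf.
  by exists 0 => _ [y _ <-]; exact: sqrtr_ge0.
by exists (pr x) => //; exact: (prP x).1.
Qed.

Lemma compact_norm_le (A : set 'rV[R]_d) :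
  compact A -> exists M, forall u, A u -> `|u| <= M.
Proof.
move=> /compact_bounded[M [_ hM]]; exists (M + 1) => u Au.
by apply: (hM (M + 1)) Au; rewrite ltrDl.
Qed.

Lemma compact_separation (A B : set 'rV[R]_d) : compact A -> compact B ->
  A `&` B = set0 ->
  exists2 e : R, 0 < e & forall u z, A u -> B z -> e <= `|u - z|.
Proof.
move=> cA cB AB0.
have [[[a b] [/= Aa Bb]]|AB] := pselect (A `*` B !=set0); last first.
  by exists 1 => // u z Au Bz; exfalso; apply: AB; exists (u, z).
pose f (uz : 'rV[R]_d * 'rV[R]_d) : R := `|uz.1 - uz.2|.
have cf : continuous f.
  move=> uz; apply: (@continuous_comp _ _ _ (fun uz : 'rV[R]_d * 'rV[R]_d => uz.1 - uz.2)).
    exact: sub_continuous.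
  exact: norm_continuous.
have [[u z] /set_mem[/= Au Bz] uzmin] := compact_EVT_min
  (ex_intro _ (a, b) (conj Aa Bb)) (compact_setX cA cB) (continuous_subspaceT cf).
exists (f (u, z)); last by move=> u' z' Au' Bz'; apply: (uzmin (u', z')); exact/mem_set.
rewrite normr_gt0 subr_eq0; apply/eqP => /= E.
have : (A `&` B) u by split=> //; rewrite E.
by rewrite AB0.
Qed.

Lemma finite_common_bound (I : finType) (P : I -> R -> Prop) :
  (forall i c c', P i c -> c <= c' -> P i c') -> (forall i, exists c, P i c) ->
  exists c, forall i, P i c.
Proof.
move=> mono /choice[f hf]; exists (\big[Num.max/0]_i f i) => i.
exact: mono (hf i) (le_bigmax _ _ i).
Qed.

Lemma finite_common_gap (I : finType) (P : I -> R -> Prop) :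
  (forall i c c', P i c -> c' <= c -> P i c') ->
  (forall i, exists2 c, 0 < c & P i c) -> exists2 c, 0 < c & forall i, P i c.
Proof.
move=> mono hP.
have /choice[f hf] : forall i, exists c, 0 < c /\ P i c.
  by move=> i; have [c] := hP i; exists c.
exists (\big[Num.min/1]_i f i).
  by apply/bigmin_gtP; split => // i _; exact: (hf i).1.
move=> i; exact: mono (hf i).2 (bigmin_le _ i _).
Qed.

(** Provides the directional increment bound of the path argument from the coordinatewise integral
    equation. *)
Lemma increment_le (b : R -> 'rV[R]_d) (Y : R -> 'rV[R]_d) (y0 : 'rV[R]_d) T :
  (forall t, 0 <= t < T -> forall i,
    mu.-integrable `[0, t] (fun s => (b s ord0 i)%:E) /\
    Y t ord0 i = y0 ord0 i + \int[mu]_(s in `[0, t]) b s ord0 i) ->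
  forall s t v c, 0 <= s -> s <= t -> t < T ->
  (forall r, s <= r <= t -> dot v (b r) <= c) -> dot v (Y t - Y s) <= c * (t - s).
Proof.
move=> hY s t v c s0 st tT bc.
have tT' : 0 <= t < T by rewrite (le_trans s0 st).
have sT' : 0 <= s < T by rewrite s0 (le_lt_trans st).
have ist i : mu.-integrable `]s, t] (fun r => (b r ord0 i)%:E).
  have [it _] := hY t tT' i; apply: integrableS it => //.
  by apply: subset_itvr; rewrite bnd_simp.
have dY i : (Y t - Y s) ord0 i = \int[mu]_(r in `]s, t]) b r ord0 i.
  rewrite !mxE; have [it ->] := hY t tT' i; have [_ ->] := hY s sT' i.
  rewrite opprD addrACA subrr add0r Rintegral_itvB// bnd_simp//.
have fst' i : mu.-integrable `]s, t] (fun r => (v ord0 i * b r ord0 i)%:E).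
  exact: (@integrableZl _ _ _ mu `]s, t]%classic (measurable_itv _) _ _ (ist i)).
have int_dot : mu.-integrable `]s, t] (fun r => (dot v (b r))%:E).
  rewrite (_ : (fun r => _) = fun r => (\sum_(i < d) (v ord0 i * b r ord0 i)%:E)%E).
    apply: (@integrable_sum _ _ _ mu `]s, t]%classic (measurable_itv _)) => i _.
    exact: fst'.
  by apply/funext => r; rewrite sumEFin.
have -> : dot v (Y t - Y s) = \int[mu]_(r in `]s, t]) dot v (b r).
  rewrite /dot /Rintegral; under [in RHS]eq_integral do rewrite -sumEFin.
  rewrite (@integral_sum _ _ _ mu `]s, t]%classic (measurable_itv _) _ _ fst').
  rewrite -sum_fine => [|i _]; last exact: integrable_fin_num.
  by apply: eq_bigr => i _; rewrite dY -RintegralZl//; exact: ist.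
have lst : mu `]s, t] = (t - s)%:E.
  rewrite lebesgue_measure_itv/= lte_fin; case: ltP => [_|ts]; first by rewrite EFinB.
  by congr EFin; lra.
apply: (@le_trans _ _ (\int[mu]_(r in `]s, t]) c)); last first.
  by rewrite Rintegral_cst// [X in fine X]lst.
apply: le_Rintegral => //.
  apply/integrableP; split; first exact/measurable_EFinP.
  by rewrite integral_cst// [X in (_ * X)%E]lst -EFinM ltry.
by move=> r /=; rewrite in_itv/= => /andP[sr rt]; apply: bc; rewrite ltW.
Qed.

End assembly.

Theorem theorem4p1
  (R : realType) (d : nat) (I : finType) (eta0 : I)
  (w : I -> R) (p : I -> 'rV[R]_d -> R) (K : I -> set 'rV[R]_d)
  (T gamma : R)
  (disp : measure_display) (Omega : measurableType disp)
  (P : probability Omega R) (F : R -> set (set Omega))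
  (B X : R -> Omega -> 'rV[R]_d) (x0 : 'rV[R]_d) :
  (1 <= d)%N ->
  (forall eta, 0 <= w eta) ->
  \sum_(eta : I) w eta = 1 ->
  0 < w eta0 ->
  (forall eta, is_density (p eta)) ->
  (forall eta u, ~ K eta u -> p eta u = 0) ->
  (forall eta, convex_set (K eta)) ->
  (forall eta, compact (K eta)) ->
  (forall eta, (K eta)° !=set0) ->
  (forall eta eta', eta != eta' -> K eta `&` K eta' = set0) ->
  0 < inf [set p eta0 x | x in K eta0] ->
  0 < T ->
  1 <= gamma ->
  filtration F ->
  brownian_motion P F B ->
  sde_solution P F B T (guided_drift w p T gamma eta0) (Num.sqrt 2) x0 X ->
  {ae P, forall omega, dist_to (X t omega) (K eta0) @[t --> T^'-] --> (0 : R)}.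
Proof.
move=> _ w0 w1 weta0 dp supp cvK cK K0 disjK infp T0 g1 _ [_ _ cB _ _] [_ cX eqX].
have [M hM] : exists M, forall eta u, K eta u -> `|u| <= M.
  apply: (finite_common_bound (P := fun eta M => forall u, K eta u -> `|u| <= M)).
    by move=> eta c c' hc cc' u /hc uc; exact: le_trans cc'.
  by move=> eta; exact: compact_norm_le.
have [delta delta0 hdelta] : exists2 delta : R, 0 < delta &
    forall eta, eta != eta0 -> forall u z, K eta u -> K eta0 z -> delta <= `|u - z|.
  apply: (finite_common_gap (P := fun eta delta => eta != eta0 ->
    forall u z, K eta u -> K eta0 z -> delta <= `|u - z|)).
    by move=> eta c c' hc cc' ne u z Ku Kz; apply: le_trans cc' _; exact: hc.
  move=> eta; have [->|ne] := eqVneq eta eta0; first by exists 1.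
  by have [e e0 he] := compact_separation (cK eta) (cK eta0) (disjK _ _ ne); exists e.
have pK eta u : p eta u != 0 -> K eta u.
  by move=> pu; apply: contrapT => /supp /eqP; exact/negP.
have pM eta u : p eta u != 0 -> `|u| <= M by move=> /pK; exact: hM.
have Keta0 : K eta0 !=set0.
  by have [z Kz] := K0 eta0; exists z; exact: nbhs_singleton.
have [z0 Kz0] := Keta0.
have M0 : 0 <= M by exact: le_trans (hM _ _ Kz0).
have [pr prP] := projection_exists (cK eta0) (cvK eta0) Keta0.
pose pm := mixture w p.
have dpm : is_density pm by exact: mixture_density.
have pmM u : pm u != 0 -> `|u| <= M by exact: mixture_support.
have p_ge0 eta u : 0 <= p eta u by have [_ + _] := dp eta.
pose c0 := inf [set p eta0 x | x in K eta0].
have p0c u : K eta0 u -> c0 <= p eta0 u.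
  by move=> Ku; apply: ge_inf; [exists 0 => _ [z _ <-]|exists u].
have w_le u : w eta0 * p eta0 u <= pm u.
  by rewrite /pm /mixture (bigD1 eta0)//= lerDl sumr_ge0// => eta _; rewrite mulr_ge0.
have sep u z : pm u != w eta0 * p eta0 u -> K eta0 z -> delta <= `|u - z|.
  move=> pmu Kz; apply: contrapT => far; move/eqP : pmu; apply.
  rewrite /pm /mixture (bigD1 eta0)//= big1 ?addr0// => eta ne.
  have [->|/pK Ku] := eqVneq (p eta u) 0; first by rewrite mulr0.
  by exfalso; apply: far; exact: (hdelta eta ne u z Ku Kz).
have drift_est V := @guided_mean_estimate _ _ _ _ _ _ _ _ _ _ prP (cvK eta0)
  (hM eta0) (K0 eta0) (dp eta0) dpm (@pK eta0) pmM weta0 infp delta0 p0c w_le sep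
  gamma V T g1.
(* From here on [omega] is fixed and the argument is deterministic. *)
apply: filterS (filterI cB (filterI cX eqX)) => omega [{}cB [{}cX {}eqX]].
pose n s : 'rV[R]_d := Num.sqrt 2 *: (B s omega - B T omega).
pose mt s : 'rV[R]_d := gamma *: post_mean (p eta0) (T - s) (X s omega) +
  (1 - gamma) *: post_mean pm (T - s) (X s omega).
have driftE s : s < T -> guided_drift w p T gamma eta0 s (X s omega) =
    ou_drift T (X ^~ omega) mt s.
  by move=> sT; rewrite (guided_driftE w0 w1 dp pM).
have T_ge0 : `[0, +oo[%classic T by rewrite /= in_itv/= andbT ltW.
have s2 : 0 < Num.sqrt 2 :> R by rewrite sqrtr_gt0.
have cBe s e : 0 <= s -> 0 < e -> exists2 h0, 0 < h0 &
    forall r, 0 <= r -> `|r - s| < h0 -> Num.sqrt 2 * `|B r omega - B s omega| < e.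
  move=> s0 e0; have e2 : 0 < e / Num.sqrt 2 by rewrite divr_gt0.
  have sA : `[0, +oo[%classic s by rewrite /= in_itv/= s0.
  have [h h0 hB] := within_continuous_dist cB sA e2.
  exists h => // r r0 rs; rewrite mulrC -ltr_pdivlMr//; apply: hB => //.
  by rewrite /= in_itv/= r0.
have Xcont : dist_continuous 0 T (X ^~ omega).
  move=> s e sT e0; have sA : `[0, T[%classic s by rewrite /= in_itv/=.
  have [h h0 hX] := within_continuous_dist cX sA e0.
  by exists h => // r rT; apply: hX; rewrite /= in_itv/=.
have ncont : dist_continuous 0 T n.
  move=> s e /andP[s0 _] e0; have [h h0 hB] := cBe s e s0 e0.
  exists h => // r /andP[r0 _] rs; rewrite /n -scalerBr opprB addrA subrK.
  by rewrite normrZ gtr0_norm//; exact: hB.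
have n0 e : 0 < e -> exists2 s0, 0 <= s0 < T & forall r, s0 <= r < T -> `|n r| <= e.
  move=> e0; have [h h0 hB] := cBe T e (ltW T0) e0.
  exists (Num.max 0 (T - h / 2)).
    by rewrite le_max lexx/= gt_max T0/=; lra.
  move=> r /andP[]; rewrite ge_max => /andP[r0 rh] rT.
  rewrite /n normrZ gtr0_norm// ltW//; apply: hB => //.
  by rewrite ltr0_norm ?subr_lt0//; lra.
have incr s t v c : 0 <= s -> s <= t -> t < T ->
    (forall r, s <= r <= t -> dot v (ou_drift T (X ^~ omega) mt r) <= c) ->
    dot v (X t omega - n t - (X s omega - n s)) <= c * (t - s).
  move=> s0 st tT hc.
  (* Subtracting [n] cancels [B t] and leaves the constant [Num.sqrt 2 *: B T omega], which joins
     the starting point. *)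
  apply: (@increment_le _ _ (fun s => guided_drift w p T gamma eta0 s (X s omega))
    (fun s => X s omega - n s) (x0 + Num.sqrt 2 *: B T omega) T) => //.
    move=> r rT i; have [ib Xr] := eqX r rT i; split => //.
    by rewrite [LHS]mxE Xr /n !mxE; ring.
  by move=> r /andP[sr rt]; rewrite driftE ?(le_lt_trans rt)//; apply: hc; rewrite sr.
have mtM s : 0 <= s < T -> `|mt s| <= (gamma + (gamma - 1)) * M.
  move=> /andP[_ sT]; have Ts : 0 < T - s by rewrite subr_gt0.
  apply: le_trans (ler_normD _ _) _; rewrite !normrZ mulrDl.
  rewrite gtr0_norm ?(lt_le_trans ltr01)// distrC ger0_norm ?subr_ge0//.
  have g0 : 0 <= gamma by exact: le_trans g1.
  apply: lerD; apply: ler_wpM2l; rewrite ?subr_ge0//.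
    exact: post_mean_norm (dp eta0) (@pM eta0) _ M0.
  exact: post_mean_norm dpm pmM _ M0.
have mtP b : exists C, forall s, 0 <= s < T -> `|X s omega| <= b ->
    let y := (ou_scale (T - s))^-1 *: X s omega in
    dot (y - pr y) (mt s - y) <= - sqr_dist_proj pr y + C * (T - s).
  (* A bound on the residual of [y] when the path is bounded by [b]: compare with the residual at 0,
     using that dividing by the scale costs at most [(ou_scale T)^-1]. *)
  pose V := `|0 - pr 0| + (1 + d%:R) * ((ou_scale T)^-1 * `|b|).
  have V0 : 0 <= V.
    by rewrite addr_ge0// mulr_ge0// ?addr_ge0// mulr_ge0// invr_ge0 ltW ?ou_scale_gt0.
  have [C _ hC] := drift_est V V0 T0; exists C => s /andP[s0 sT] Xb /=.
  have l0 := @ou_scale_gt0 R (T - s).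
  set y := _ *: X s omega.
  have yE : X s omega = ou_scale (T - s) *: y by rewrite scalerA mulfV ?gt_eqF// scale1r.
  rewrite /mt yE; apply: hC; first by rewrite subr_gt0 sT/=; lra.
  rewrite -[y - pr y](subrK (0 - pr 0)) addrC; apply: le_trans (ler_normD _ _) _.
  rewrite lerD2l; apply: le_trans (proj_residual_lipschitz _ _ prP) _.
  rewrite ler_wpM2l ?addr_ge0// subr0 normrZ gtr0_norm ?invr_gt0//.
  apply: ler_pM => //; first by rewrite invr_ge0 ltW.
    by rewrite lef_pV2 ?posrE ?ou_scale_gt0// ler_expR; lra.
  by apply: le_trans Xb _; exact: ler_norm.
have path := path_sqr_dist_cvg0 T0 Xcont ncont n0 incr mtM prP mtP.
apply/cvgrPdist_le => e e0.
have e2 : 0 < e ^+ 2 by rewrite exprn_gt0.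
have [s /andP[s_ge0 sT] hs] := path _ e2.
near=> t.
have tT : t < T by near: t; exact: nbhs_left_lt.
have st : s <= t by near: t; exact: nbhs_left_ge.
have /andP[d_ge0 d_le] := dist_to_projection (X t omega) prP.
rewrite sub0r normrN ger0_norm//; apply: le_trans d_le _.
rewrite -(ger0_norm (ltW e0)) -sqrtr_sqr ler_wsqrtr//.
by apply: hs; rewrite st tT.
Unshelve. all: by end_near.
Qed.
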